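(* Let $1<p<\infty$ and let $X=(X,d,\mu)$ be a metric space with at least two points, equipped with a positive complete Borel measure $\mu$ such that $0<\mu(B)<\infty$ for all balls $B\subset X$. Assume that $E\subset A$ are bounded subsets of $X$ such that $\operatorname{cap}_p(E,A)<\infty$ and let $u$ be a capacitary potential of $(E,A)$. Let $A_a=\{x\in A:u(x)>a\}$ and $A^a=\{x\in A:u(x)\ge a\}$. Then $$\operatorname{cap}_p(A^b,A_a)=\operatorname{cap}_p(A^b,A^a)=(b-a)^{1-p}\operatorname{cap}_p(E,A)\quad\text{if }0\le a<b\le1,$$ $$\operatorname{cap}_p(A_b,A_a)=\operatorname{cap}_p(A_b,A^a)=(b-a)^{1-p}\operatorname{cap}_p(E,A)\quad\text{if }0\le a<b<1.$$
   Context: The measure $\mu$ is defined on the completion of the Borel $\sigma$-algebra. No completeness, doubling or Poincaré assumption is made, and $E$, $A$ need not be measurable. Curves are nonconstant, compact, rectifiable and parameterized by arc length $ds$. A measurable $g\colon X\to[0,\infty]$ is a $p$-weak upper gradient of $f\colon X\to[-\infty,\infty]$ if $|f(\gamma(0))-f(\gamma(l_\gamma))|\le\int_\gamma g\,ds$ for all curves $\gamma\colon[0,l_\gamma]\to X$ outside some family $\Gamma$ for which there is $0\le\rho\in L^p(X)$ with $\int_\gamma\rho\,ds=\infty$ for every $\gamma\in\Gamma$ (the left-hand side is $\infty$ if a term in it is $\pm\infty$). If $f$ has a $p$-weak upper gradient in $L^p_{\rm loc}(X)$, then $g_f$ denotes its a.e. unique minimal one. $N^{1,p}(X)$ is the set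 of measurable, everywhere defined $f\colon X\to[-\infty,\infty]$ with $\|f\|_{N^{1,p}(X)}^p=\int_X|f|^p\,d\mu+\inf_g\int_Xg^p\,d\mu<\infty$ (infimum over $p$-weak upper gradients of $f$). Sobolev capacity: $C_p(E)=\inf\|u\|_{N^{1,p}(X)}^p$ over $u\in N^{1,p}(X)$ with $u\ge1$ on $E$; q.e. means outside a set of $C_p$-capacity zero. Variational capacity: for bounded $E\subset A$, $\operatorname{cap}_p(E,A)=\inf\int_Xg_u^p\,d\mu$ over $u\in N^{1,p}(X)$ with $u\ge1$ on $E$ and $u=0$ on $X\setminus A$ (and $\infty$ if no such $u$ exists). One can equivalently take the infimum over all $u\in N^{1,p}(X)$ with $u\ge1$ q.e. on $E$ and $u=0$ q.e. on $X\setminus A$; such $u$ are called admissible. A capacitary potential of $(E,A)$ is an admissible function for which the infimum is attained. *)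

(* Defs.v *)
From HB Require Import structures.
From mathcomp Require Import all_boot all_order all_algebra.
From mathcomp Require Import all_classical all_reals all_analysis.
From mathcomp Require Import measurable_realfun.

Set Implicit Arguments.
Unset Strict Implicit.
Unset Printing Implicit Defensive.

Import Order.TTheory GRing.Theory Num.Theory.
Import numFieldNormedType.Exports.

Local Open Scope classical_set_scope.
Local Open Scope ring_scope.

#[short(type="metricMeasurableType")]
HB.structure Definition MetricMeasurable (R : realType) (d : measure_display) :=
  { T of Metric R T & Measurable d T }.

Section metric_curves.
Context {R : realType} {X : metricType R}.

Definition bounded_subset (E : set X) : Prop :=
  exists (x : X) (r : R), E `<=` ball x r.

Definition metric_variation (a b : R) (g : R -> X) (s : seq R) : R :=
  let F := g \o nth b (a :: s) in
  \sum_(0 <= n < size s) mdist (F n) (F n.+1).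

Definition curve_length (a b : R) (g : R -> X) : \bar R :=
  ereal_sup [set (metric_variation a b g s)%:E | s in itv_partition a b].

End metric_curves.

(* A nonconstant compact rectifiable curve [0, len] -> X parameterized by arc
   length; the values of the underlying function outside [0, len] are junk.
   In the presence of the last field, nonconstant means exactly 0 < len.  *)
Record curve {R : realType} (X : metricType R) := Curve {
  curve_len : R ;
  curve_fun :> R -> X ;
  curve_len_gt0 : 0 < curve_len ;
  curve_continuous : {within `[0, curve_len], continuous curve_fun} ;
  curve_arc_length : forall s t, 0 <= s -> s <= t -> t <= curve_len ->
    curve_length s t curve_fun = (t - s)%:E
}.

Section newtonian.
Context {R : realType} {d : measure_display} {X : metricMeasurableType R d}.
Variables (mu : {measure set X -> \bar R}) (p : R).
Local Open Scope ereal_scope.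

(* mu is a complete Borel measure: its domain is the completion, with respect
   to mu, of the Borel sigma-algebra of the metric space X. *)
Definition complete_borel : Prop :=
  @measurable d X =
  completed_algebra_gen (mu : set (g_sigma_algebraType (@open X)) -> \bar R).

(* For a nonnegative integrand that is not Borel measurable along the curve,
   \int is a supremum over the Borel simple functions below it; it is the usual
   Lebesgue integral as soon as g \o c is Lebesgue measurable, which, for g
   measurable on X, is the case for all curves outside an exceptional family. *)
Definition line_integral (c : curve X) (g : X -> \bar R) : \bar R :=
  \int[lebesgue_measure]_(t in `[0%R, curve_len c]) g (c t).

Definition nonneg_measurable (g : X -> \bar R) : Prop :=
  (forall x, 0 <= g x) /\ measurable_fun [set: X] g.

Definition int_pow (g : X -> \bar R) : \bar R :=
  \int[mu]_x (`|g x| `^ p).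

Definition exceptional (Gamma : set (curve X)) : Prop :=
  exists rho : X -> \bar R, [/\ nonneg_measurable rho, int_pow rho < +oo &
    forall c, Gamma c -> line_integral c rho = +oo].

(* In \bar R, `|x - y| = +oo as soon as x or y is infinite, since
   +oo - +oo = -oo - -oo = -oo. *)
Definition weak_upper_gradient (f g : X -> \bar R) : Prop :=
  nonneg_measurable g /\
  exists2 Gamma : set (curve X), exceptional Gamma &
    forall c, ~ Gamma c ->
      `|f (c 0%R) - f (c (curve_len c))| <= line_integral c g.

Definition locally_Lp (g : X -> \bar R) : Prop :=
  measurable_fun [set: X] g /\
  forall x, exists2 r : R, (0 < r)%R &
    \int[mu]_(y in ball x r) (`|g y| `^ p) < +oo.

Definition minimal_weak_upper_gradient (f g : X -> \bar R) : Prop :=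
  [/\ weak_upper_gradient f g, locally_Lp g &
   forall h, weak_upper_gradient f h -> locally_Lp h ->
     {ae mu, forall x, g x <= h x}].

(* A representative of the a.e. unique minimal p-weak upper gradient of f, and
   the constant +oo if there is none. *)
Definition min_wug (f : X -> \bar R) : X -> \bar R :=
  xget (cst +oo) (minimal_weak_upper_gradient f).

Definition newtonian_normp (f : X -> \bar R) : \bar R :=
  int_pow f + ereal_inf [set int_pow g | g in weak_upper_gradient f].

Definition newtonian : set (X -> \bar R) :=
  [set f | measurable_fun [set: X] f /\ newtonian_normp f < +oo].

Definition sobolev_capacity (E : set X) : \bar R :=
  ereal_inf [set newtonian_normp u |
    u in newtonian `&` [set u | forall x, E x -> 1 <= u x]].

Definition quasi_everywhere (P : X -> Prop) : Prop :=
  exists2 Z : set X, sobolev_capacity Z = 0 & forall x, ~ Z x -> P x.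

Definition dirichlet_energy (u : X -> \bar R) : \bar R := int_pow (min_wug u).

(* Meant for bounded sets E `<=` A. *)
Definition variational_capacity (E A : set X) : \bar R :=
  ereal_inf [set dirichlet_energy u | u in newtonian `&`
    [set u | (forall x, E x -> 1 <= u x) /\ (forall x, ~ A x -> u x = 0)]].

Definition admissible (E A : set X) (u : X -> \bar R) : Prop :=
  [/\ newtonian u, quasi_everywhere (fun x => E x -> 1 <= u x) &
      quasi_everywhere (fun x => ~ A x -> u x = 0)].

Definition capacitary_potential (E A : set X) (u : X -> \bar R) : Prop :=
  admissible E A u /\ dirichlet_energy u = variational_capacity E A.

End newtonian.

(* Main.v *)
(* Energy of the potential [u] is spread evenly over its levels: if the parts of
   [u] above and below the levels in [a, b] are stretched by one factor and the
   part in between by another so that the result is still admissible for (E, A),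
   then the energy cannot drop, and the first variation gives that
   [g_u ^ p] has integral [(b - a) cap(E, A)] over {a < u < b}.  Hence the
   truncation of [u] to [a, b], rescaled to [0, 1], has energy
   [(b - a)^(1 - p) cap(E, A)].  Conversely, if [v] competes for the condenser of
   two level sets, gluing [(b - a) v] between the parts of [u] below [a] and
   above [b] is admissible for (E, A), which bounds the energy of [v] from below.

   Minimal weak upper gradients exist because weak upper gradients are stable
   under minima and, curve by curve, under decreasing limits. *)
Require Import Defs.
From HB Require Import structures.
From mathcomp Require Import all_boot all_order all_algebra finmap.
From mathcomp Require Import all_classical all_reals all_analysis.
From mathcomp Require Import measurable_realfun ring lra.

Set Implicit Arguments.
Unset Strict Implicit.
Unset Printing Implicit Defensive.

Import Order.TTheory GRing.Theory Num.Theory.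
Import numFieldNormedType.Exports.

Local Open Scope classical_set_scope.
Local Open Scope ring_scope.

(** * Integrals and increments on the real line *)

(** Two obstacles shape the development. A weak upper gradient is measurable only for the completed
    sigma-algebra, so along a given curve [line_integral] may be a mere lower integral, which is
    monotone but need not be additive. And a potential meets its constraints only q.e., while
    [variational_capacity] tests them everywhere; hence sets of capacity zero must be shown to be
    null and missed by almost every curve, so that functions can be changed on them for free.

    Locality of minimal gradients is replaced by truncation: clamping [u] to [m, M] leaves a
    gradient only on {m < u < M}. With L = b - a and stretching factors al outside the levels and be
    between them, admissibility is the single condition al (1 - L) + be L = 1, which says that the
    total rise is 1. Energy sitting on {u = a} or {u = b} is not excluded in advance: it is left out
    of both parts, and the comparison al = be = 1 then shows that nothing was lost. *)

Section lower_integral.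
Local Open Scope ereal_scope.
Context {d : measure_display} {T : measurableType d} {R : realType}.
Variable mu : {measure set T -> \bar R}.

(** For nonnegative integrands the integral is a supremum over simple functions below, so enlarging
    the integrand enlarges the family; this also covers integrands that are not measurable along a
    curve. *)
Lemma ge0_le_lower_integral (D : set T) (f g : T -> \bar R) :
  (forall x, D x -> 0 <= f x) -> (forall x, D x -> f x <= g x) ->
  \int[mu]_(x in D) f x <= \int[mu]_(x in D) g x.
Proof.
move=> f0 fg; rewrite integral_mkcond [leRHS]integral_mkcond.
have f0' x : 0 <= (f \_ D) x by rewrite patchE; case: ifPn => // /set_mem /f0.
have fg' x : (f \_ D) x <= (g \_ D) x.
  by rewrite !patchE; case: ifPn => // /set_mem /fg.
rewrite !ge0_integralTE//; last by move=> x; exact: le_trans (f0' x) (fg' x).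
by apply: le_ereal_sup => _ [h hf <-]; exists h => // x; exact: le_trans (fg' x).
Qed.

Lemma ge0_subset_lower_integral (A B : set T) (f : T -> \bar R) :
  A `<=` B -> (forall x, B x -> 0 <= f x) ->
  \int[mu]_(x in A) f x <= \int[mu]_(x in B) f x.
Proof.
move=> AB f0; rewrite integral_mkcond [leRHS]integral_mkcond.
apply: ge0_le_lower_integral => x _; rewrite !patchE.
  by case: ifPn => // /set_mem /AB/f0.
case: ifPn => [/set_mem/AB xB|_]; first by rewrite mem_set.
by case: ifPn => // /set_mem /f0.
Qed.

Lemma integral_absolutely_continuous (D : set T) (f : T -> \bar R) :
  measurable D -> measurable_fun D f -> (forall x, D x -> 0 <= f x) ->
  \int[mu]_(x in D) f x < +oo -> forall e : R, (0 < e)%R ->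
  exists2 r : R, (0 < r)%R & forall A, measurable A -> A `<=` D ->
    mu A < r%:E -> \int[mu]_(x in A) f x < e%:E.
Proof.
move=> mD mf f0 foo e e0.
have intf : mu.-integrable D f.
  apply/integrableP; split => //; rewrite (eq_integral f)// => x /set_mem xD.
  by rewrite gee0_abs// f0.
(* [f] is finite only a.e.; [fine] puts 0 at infinite values, which changes no integral and gives a
   real-valued integrand. *)
pose g := fine \o (f \_ D).
have mfD : measurable_fun setT (f \_ D) by exact/(measurable_restrictT _ _).1.
have mg : measurable_fun setT (EFin \o g).
  by apply/measurable_EFinP; apply: measurableT_comp mfD => //.
have intfD : mu.-integrable setT (f \_ D).
  by apply/integrable_restrict => //; rewrite setTI.
have aefg : ae_eq mu setT (f \_ D) (EFin \o g).
  have := integrable_ae measurableT intfD; apply: filterS => x /(_ I) h _ /=.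
  by rewrite /g /= fineK.
have intg : mu.-integrable setT (EFin \o g).
  apply/integrableP; split => //.
  have /integrableP[_] := intfD; apply: le_lt_trans.
  apply: ge0_le_lower_integral => // x _.
  by rewrite /g /=; case: ((f \_ D) x) => [r| |]//=; rewrite normr0 leey.
have [r [r0 hr]] := integral_normr_continuous intg e0.
exists r => // A mA AD /(hr _ mA); rewrite -lte_fin; apply: le_lt_trans.
have g0 x : (0 <= g x)%R.
  by rewrite /g /= fine_ge0// patchE; case: ifPn => // /set_mem /f0.
rewrite /Rintegral fineK; last first.
  rewrite ge0_fin_numE; last by apply: integral_ge0 => x _; rewrite lee_fin.
  have /integrableP[_] := integrableS measurableT mA (@subsetT _ A) intg.
  by apply: le_lt_trans; apply: ge0_le_lower_integral.
have -> : \int[mu]_(x in A) f x = \int[mu]_(x in A) (f \_ D) x.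
  apply: eq_integral => x /set_mem /AD xD; rewrite patchE mem_set//.
rewrite (@ge0_ae_eq_integral _ _ _ mu A (f \_ D) (EFin \o g))//.
- by apply: ge0_le_lower_integral => x xA; rewrite lee_fin//= ler_norm.
- exact: measurable_funTS.
- exact: measurable_funTS.
- by move=> x /AD xD; rewrite patchE mem_set// f0.
- by move=> x _; rewrite lee_fin.
- by apply: filterS aefg => x h _; exact: h.
Qed.

End lower_integral.

Section real_line.
Context {R : realType}.
Local Notation leb := (@lebesgue_measure R).

Lemma ge0_integral_itv_split (f : R -> \bar R) (a b c : R) :
  a <= b -> b <= c -> measurable_fun `[a, c] f ->
  (forall x, `[a, c]%classic x -> (0 <= f x)%E) ->
  (\int[leb]_(x in `[a, c]) f x =
   \int[leb]_(x in `[a, b]) f x + \int[leb]_(x in `[b, c]) f x)%E.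
Proof.
move=> ab bc mf f0.
have abc : `[a, c]%classic = `[a, b] `|` `]b, c] :> set R.
  by rewrite -itv_bndbnd_setU// bnd_simp.
rewrite [in LHS]abc ge0_integral_setU//=.
- by congr (_ + _)%E; rewrite integral_itv_obnd_cbnd//;
    apply: measurable_funS mf => // x /=; rewrite !in_itv/= => /andP[bx ->];
    rewrite andbT (le_trans ab)// ltW.
- by rewrite -[X in measurable_fun X _]abc.
- move=> x hx; apply: f0; move: hx => /=; rewrite !in_itv/=.
  by move=> [/andP[ax xb]|/andP[bx xc]]; apply/andP; split; lra.
- apply/disj_setPS => x [] /=; rewrite !in_itv/= => /andP[_ xb] /andP[bx _].
  by move: xb; rewrite leNgt bx.
Qed.

Lemma subitvcc (a b s t : R) : a <= s -> t <= b ->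
  `[s, t]%classic `<=` `[a, b]%classic.
Proof.
by move=> as' tb x /=; rewrite !in_itv/= => /andP[sx xt];
  rewrite (le_trans as')// (le_trans xt).
Qed.

(** The right-hand side is additive over adjacent intervals and the left-hand side subadditive, so
    the admissible length doubles by bisection until it exceeds [b - a]. *)
Lemma local_increment_bound (F : R -> R) (phi : R -> \bar R) (a b r : R) :
  0 < r -> a <= b -> measurable_fun `[a, b] phi ->
  (forall x, `[a, b]%classic x -> (0 <= phi x)%E) ->
  (forall s t, a <= s -> s <= t -> t <= b -> t - s < r ->
     (`|F s - F t|%:E <= \int[leb]_(x in `[s, t]) phi x)%E) ->
  (`|F a - F b|%:E <= \int[leb]_(x in `[a, b]) phi x)%E.
Proof.
move=> r0 ab mphi phi0 H.
suff K n s t : a <= s -> s <= t -> t <= b -> t - s < r * 2 ^+ n ->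
    (`|F s - F t|%:E <= \int[leb]_(x in `[s, t]) phi x)%E.
  have [n hn] : exists n : nat, b - a < r * 2 ^+ n.
    exists (Num.truncn ((b - a) / r)).+1.
    rewrite mulrC -ltr_pdivrMr//.
    apply: (@lt_trans _ _ ((Num.truncn ((b - a) / r)).+1%:R)); first exact: truncnS_gt.
    by rewrite -natrX ltr_nat ltn_expl.
  exact: (K n).
elim: n s t => [|n IH] s t as' st tb; first by rewrite expr0 mulr1; exact: H.
rewrite exprS => tsr; pose m := (s + t) / 2.
have sm : s <= m by rewrite /m; lra.
have mt : m <= t by rewrite /m; lra.
have IH1 := IH s m as' sm (le_trans mt tb) _.
have IH2 := IH m t (le_trans as' sm) mt tb _.
rewrite (@ge0_integral_itv_split _ s m t)//; last 2 first.
- by apply: measurable_funS mphi => //; exact: subitvcc.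
- by move=> x /(subitvcc as' tb); exact: phi0.
have : (`|F s - F m|%:E + `|F m - F t|%:E <= \int[leb]_(x in `[s,
  m]) phi x + \int[leb]_(x in `[m, t]) phi x)%E.
  by apply: leeD; [apply: IH1|apply: IH2]; rewrite /m;
   move: tsr; set q := 2 ^+ n; move: q => q; nra.
by apply: le_trans; rewrite -EFinD lee_fin; exact: ler_distD.
Qed.

Lemma disjoint_compact_dist (K1 K2 : set R) : compact K1 -> compact K2 ->
  K1 `&` K2 = set0 ->
  exists2 r : R, 0 < r & forall x y, K1 x -> K2 y -> r <= `|x - y|.
Proof.
move=> cK1 cK2 K12.
have oK2 : open (~` K2).
  by apply: closed_openC; apply: compact_closed => //; exact: order_hausdorff.
pose P (r : R) (x : R) := forall y, K2 y -> r <= `|x - y|.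
have : \forall r \near 0^'+, K1 `<=` P r.
  have /compact_near_coveringP := cK1; apply => x K1x.
  have : nbhs x (~` K2).
    by apply: open_nbhs_nbhs; split => // K2x; rewrite -[False]/(set0 x) -K12.
  move=> /nbhs_ballP[e /= e0 xe].
  have e20 : 0 < e / 2 by rewrite divr_gt0.
  near=> z r => y K2y; rewrite leNgt; apply/negP => zyr.
  apply: (xe y) => //; rewrite -ball_normE /=.
  have h1 : `|x - z| < e / 2 by near: z; apply: (nbhsx_ballx x (e / 2) e20).
  have h2 : r < e / 2 by near: r; exact: nbhs_right_lt.
  apply: le_lt_trans (ler_distD z x y) _; rewrite (splitr e); apply: ltrD => //.
  exact: lt_trans zyr h2.
move=> /(filterI (nbhs_right_gt 0))/filter_ex[r [/= r0 h]].
by exists r => // x y K1x; exact: h.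
Unshelve. all: by end_near. Qed.

(* Compact sets [K1] and [K2], inside the sets where [phi1] resp. [phi2] is the
   smaller function, exhaust [a, b] up to small measure and lie at a positive
   distance, so a short interval misses one of them. *)
Lemma min_increment_bound (F : R -> R) (phi1 phi2 : R -> \bar R) (a b : R) :
  a <= b ->
  measurable_fun `[a, b] phi1 -> measurable_fun `[a, b] phi2 ->
  (forall x, `[a, b]%classic x -> (0 <= phi1 x)%E) ->
  (forall x, `[a, b]%classic x -> (0 <= phi2 x)%E) ->
  (\int[leb]_(x in `[a, b]) phi1 x < +oo)%E ->
  (\int[leb]_(x in `[a, b]) phi2 x < +oo)%E ->
  (forall s t, a <= s -> s <= t -> t <= b ->
     (`|F s - F t|%:E <= \int[leb]_(x in `[s, t]) phi1 x)%E) ->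
  (forall s t, a <= s -> s <= t -> t <= b ->
     (`|F s - F t|%:E <= \int[leb]_(x in `[s, t]) phi2 x)%E) ->
  (`|F a - F b|%:E <= \int[leb]_(x in `[a, b]) mine (phi1 x) (phi2 x))%E.
Proof.
move=> ab m1 m2 p1 p2 i1 i2 F1 F2.
set D := `[a, b]%classic : set R.
pose psi x := (phi1 x + phi2 x)%E.
have mD : measurable D by exact: measurable_itv.
have mpsi : measurable_fun D psi by exact: emeasurable_funD.
have psi0 x : D x -> (0 <= psi x)%E by move=> Dx; apply: adde_ge0; auto.
have psioo : (\int[leb]_(x in D) psi x < +oo)%E.
  by rewrite ge0_integralD// lte_add_pinfty.
have mmin : measurable_fun D (fun x => mine (phi1 x) (phi2 x)).
  exact: measurable_mine.
have min0 x : D x -> (0 <= mine (phi1 x) (phi2 x))%E.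
  by move=> Dx; rewrite le_min p1//= p2.
pose S := D `&` [set x | phi1 x <= phi2 x]%E.
have mS : measurable S by exact: emeasurable_fun_le.
have mT : measurable (D `\` S) by exact: measurableD.
have lebD : (leb D < +oo)%E.
  by rewrite /D lebesgue_measure_itv/=; case: ifP => // _; rewrite -EFinB ltry.
apply/lee_addgt0Pr => e e0.
have [r0 r00 hr0] :=
  @integral_absolutely_continuous _ (measurableTypeR R) R leb D psi mD mpsi psi0 psioo e e0.
have r02 : 0 < r0 / 2 by rewrite divr_gt0.
have lebS : (leb S < +oo)%E.
  by apply: le_lt_trans lebD; apply: le_measure; rewrite ?inE// => x [].
have lebT : (leb (D `\` S) < +oo)%E.
  by apply: le_lt_trans lebD; apply: le_measure; rewrite ?inE// => x [].
have [K1 [cK1 K1S hK1]] := lebesgue_regularity_inner mS lebS r02.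
have [K2 [cK2 K2T hK2]] := lebesgue_regularity_inner mT lebT r02.
have K12 : K1 `&` K2 = set0.
  by rewrite -subset0 => x [/K1S ? /K2T []].
have [r r_gt0 hr] := disjoint_compact_dist cK1 cK2 K12.
have mK1 : measurable K1 by exact: compact_measurable.
have mK2 : measurable K2 by exact: compact_measurable.
pose A := (S `\` K1) `|` ((D `\` S) `\` K2).
have mA : measurable A by apply: measurableU; exact: measurableD.
have AD : A `<=` D by move=> x [[[]]|[[]]].
have hA : (\int[leb]_(x in A) psi x < e%:E)%E.
  apply: hr0 => //; apply: le_lt_trans (measureU2 _ _ _) _; try exact: measurableD.
  by rewrite (splitr r0) EFinD; apply: lteD.
(* On the small leftover [A] the extra term lifts [Phi] above both functions, at a total cost below
   [e]; off [A] every point of [a, b] lies in [K1] or [K2]. *)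
pose Phi x := (mine (phi1 x) (phi2 x) + (psi \_ A) x)%E.
have mpA : measurable_fun D (psi \_ A).
  by apply/measurable_restrict => //; apply: measurable_funS mpsi => // x [].
have pA0 x : D x -> (0 <= (psi \_ A) x)%E.
  by move=> Dx; rewrite patchE; case: ifPn => // _; exact: psi0.
have mPhi : measurable_fun D Phi by exact: emeasurable_funD.
have Phi0 x : D x -> (0 <= Phi x)%E.
  by move=> Dx; apply: adde_ge0; [exact: min0|exact: pA0].
have bigA x : D x -> A x -> (phi1 x <= Phi x /\ phi2 x <= Phi x)%E.
  move=> Dx Ax; rewrite /Phi patchE mem_set// /psi; split.
    by apply: le_trans (leeDr _ (min0 x Dx)); apply: leeDl; exact: p2.
  by apply: le_trans (leeDr _ (min0 x Dx)); apply: leeDr; exact: p1.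
have : (`|F a - F b|%:E <= \int[leb]_(x in `[a, b]) Phi x)%E.
  apply: (@local_increment_bound F Phi a b r) => // s t as' st tb tsr.
  (* An interval shorter than [r] that meets [K2] misses [K1], so off [A] it stays where [phi2] is
     the minimum; one that misses [K2] stays where [phi1] is. *)
  have [[y [yst K2y]]|nK2] := pselect (exists y, `[s, t]%classic y /\ K2 y).
    apply: le_trans (F2 s t as' st tb) _.
    apply: ge0_le_lower_integral => x xst; have Dx := subitvcc as' tb xst.
      exact: p2.
    have [Ax|nAx] := pselect (A x); first exact: (bigA x Dx Ax).2.
    have nK1x : ~ K1 x.
      move=> K1x; have := hr x y K1x K2y; apply/negP; rewrite -ltNge.
      move: xst yst; rewrite /= !in_itv/= => /andP[sx xt] /andP[sy yt].
      by rewrite ltr_norml; apply/andP; split; lra.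
    have nSx : ~ S x by move=> Sx; apply: nAx; left.
    rewrite /Phi patchE memNset// adde0 le_min lexx andbT leNgt.
    by apply/negP => lt12; apply: nSx; split => //=; exact: ltW.
  apply: le_trans (F1 s t as' st tb) _.
  apply: ge0_le_lower_integral => x xst; have Dx := subitvcc as' tb xst.
    exact: p1.
  have [Ax|nAx] := pselect (A x); first exact: (bigA x Dx Ax).1.
  have nK2x : ~ K2 x by move=> K2x; apply: nK2; exists x.
  have Sx : S x by apply: contrapT => nSx; apply: nAx; right.
  by rewrite /Phi patchE memNset// adde0 le_min lexx/=; case: Sx.
move=> /le_trans; apply; rewrite ge0_integralD//.
apply: leeD => //; apply: le_trans (ltW hA).
rewrite [in leRHS]integral_mkcond.
by rewrite -/D; apply: ge0_subset_lower_integral => // x _; rewrite patchE;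
  case: ifPn => // /set_mem /AD /psi0.
Qed.

End real_line.

(** * Level crossings and truncated increments *)

Section crossing.
Context {R : realType}.
Local Notation leb := (@lebesgue_measure R).

Definition clampr (m M x : R) : R := Num.max m (Num.min x M).

Lemma clampr_itv (m M x : R) : m <= M -> m <= clampr m M x <= M.
Proof. by move=> mM; rewrite /clampr le_max lexx/= ge_max mM/= ge_min lexx orbT. Qed.

Lemma clampr_id (m M x : R) : m <= x <= M -> clampr m M x = x.
Proof. by move=> /andP[mx xM]; rewrite /clampr min_l// max_r. Qed.

Lemma clamprN (m M x : R) : m <= M -> clampr (- M) (- m) (- x) = - clampr m M x.
Proof.
move=> mM; rewrite /clampr -oppr_max [RHS]oppr_max.
case: (leP x m) => xm; case: (leP x M) => xM;
  rewrite ?(max_r xm) ?(max_l (ltW xm)) ?(min_l xM) ?(min_r (ltW xM));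
  rewrite /Num.min /Num.max; repeat case: ifP; lra.
Qed.

Lemma clampr_contraction (m M x y : R) : `|clampr m M x - clampr m M y| <= `|x - y|.
Proof.
rewrite /clampr /Num.min /Num.max; case: (ltP x y) => xy;
  [rewrite (ltr0_norm (_ : x - y < 0)) ?subr_lt0//|rewrite (ger0_norm (_ : 0 <= x - y))
    ?subr_ge0//];
  rewrite ler_norml; repeat case: ifP; lra.
Qed.

Lemma continuous_clampr (m M : R) : continuous (clampr m M).
Proof.
move=> x; apply/cvgrPdist_lt => e e0; near=> y.
apply: le_lt_trans (clampr_contraction m M x y) _.
by near: y; apply: (nbhsx_ballx x e e0).
Unshelve. all: by end_near. Qed.

Lemma continuous_last_below (F : R -> R) (a b al : R) : continuous F ->
  a <= b -> F a <= al ->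
  exists2 t, a <= t <= b & F t <= al /\ forall s, t < s -> s <= b -> al < F s.
Proof.
move=> cF ab Fa; pose S := `[a, b]%classic `&` F @^-1` `]-oo, al]%classic.
have Sa : S a by split; rewrite /= in_itv//= lexx.
have ubS : ubound S b by move=> x [/=]; rewrite in_itv/= => /andP[].
have cS : closed S.
  apply: closedI; first exact: interval_closed.
  by apply: (continuous_closedP F).1 => //; exact: lray_closed.
have : S (sup S).
  by rewrite {1}(closure_id S).1//; apply: closure_sup; [exists a|exists b].
move=> [/=]; rewrite !in_itv/= => abS FS; exists (sup S) => //; split=> // s Ss sb.
rewrite ltNge; apply/negP => Fs; move: (Ss); rewrite ltNge => /negP; apply.
apply: ub_le_sup; first by exists b.
by split; rewrite /= in_itv//= sb andbT; case/andP: abS => aS _; rewrite (le_trans aS)// ltW.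
Qed.

Lemma continuous_crossing (F : R -> R) (a b al be : R) : continuous F ->
  a <= b -> F a <= al -> al < be -> be <= F b ->
  exists t1 t2, [/\ a <= t1, t1 < t2, t2 <= b, F t1 <= al & be <= F t2 /\
    forall s, t1 < s -> s < t2 -> al < F s < be].
Proof.
move=> cF ab Fa albe Fb.
have [t1 /andP[at1 t1b] [Ft1 hb]] := continuous_last_below cF ab Fa.
(* The first time after [t1] at which [F] reaches [be] is the last time below a level for the
   function reflected in both variables. *)
have cG : continuous (fun t => - F (- t)).
  move=> t; apply: cvgN; apply: (@cvg_comp _ _ _ -%R F); last exact: cF.
  exact: opp_continuous.
have [||t2 /andP[bt2 t2t1] [Ft2 hb2]] := @continuous_last_below _ (- b) (- t1) (- be) cG.
- by rewrite lerN2.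
- by rewrite opprK lerN2.
exists t1, (- t2); move: Ft2; rewrite lerN2 => Ft2.
have t1t2 : t1 <= - t2 by lra.
split => //; first (rewrite lt_neqAle t1t2 andbT; apply/eqP => t12;
  by move: Ft2; rewrite -t12; lra); first lra.
split => // s t1s st2; rewrite hb//; last by lra.
by have := hb2 (- s); rewrite opprK ltrN2 => ->//; lra.
Qed.

(** The increment is already achieved on one crossing interval, in whose interior [F] stays strictly
    between the two clamped values and hence strictly between [m] and [M]. *)
Lemma clamp_increment_lt (F : R -> R) (phi : R -> \bar R) (a b m M : R) :
  continuous F -> a <= b -> measurable_fun `[a, b] phi ->
  (forall x, `[a, b]%classic x -> (0 <= phi x)%E) ->
  (forall s t, a <= s -> s <= t -> t <= b ->
     (`|F s - F t|%:E <= \int[leb]_(x in `[s, t]) phi x)%E) ->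
  m <= M -> clampr m M (F a) < clampr m M (F b) ->
  ((clampr m M (F b) - clampr m M (F a))%:E <=
     \int[leb]_(x in `[a, b]) (if (m < F x < M)%R then phi x else 0))%E.
Proof.
move=> cF ab mphi phi0 hF mM lt_ab.
(* This fails only if [F a > M], and the next inequality only if [F b < m]; either would contradict
   the strict growth of the clamped values. *)
have Fa : F a <= clampr m M (F a).
  by move: lt_ab; rewrite /clampr /Num.min /Num.max; repeat case: ifP; lra.
have Fb : clampr m M (F b) <= F b.
  by move: lt_ab; rewrite /clampr /Num.min /Num.max; repeat case: ifP; lra.
have [t1 [t2 [at1 t12 t2b Ft1 [Ft2 hs]]]] := continuous_crossing cF ab Fa lt_ab Fb.
have /andP[ma _] := clampr_itv (F a) mM; have /andP[_ bM] := clampr_itv (F b) mM.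
apply: (@le_trans _ _ (\int[leb]_(x in `[t1, t2]) phi x)%E).
  apply: le_trans (hF t1 t2 at1 (ltW t12) t2b).
  by rewrite lee_fin distrC; apply: le_trans (ler_norm _); lra.
have sub : `]t1, t2[%classic `<=` `[a, b]%classic.
  by move=> x /=; rewrite !in_itv/= => /andP[? ?]; apply/andP; split; lra.
have mphi' : measurable_fun `]t1, t2[ phi by apply: measurable_funS mphi.
have -> : (\int[leb]_(x in `[t1, t2]) phi x = \int[leb]_(x in `]t1, t2[) phi x)%E.
  exact: integral_itv_bndoo.
apply: (@le_trans _ _
  (\int[leb]_(x in `]t1, t2[) (if (m < F x < M)%R then phi x else 0))%E).
  apply: ge0_le_lower_integral => x xt.
    exact/phi0/sub.
  move: xt; rewrite /= in_itv/= => /andP[t1x xt2].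
  have /andP[h1 h2] := hs x t1x xt2.
  by rewrite (le_lt_trans ma h1) (lt_le_trans h2 bM).
by apply: ge0_subset_lower_integral => // x xab; case: ifP => // _; exact: phi0.
Qed.

Lemma clamp_increment_bound (F : R -> R) (phi : R -> \bar R) (a b m M : R) :
  a <= b -> measurable_fun `[a, b] phi ->
  (forall x, `[a, b]%classic x -> (0 <= phi x)%E) ->
  (\int[leb]_(x in `[a, b]) phi x < +oo)%E ->
  (forall s t, a <= s -> s <= t -> t <= b ->
     (`|F s - F t|%:E <= \int[leb]_(x in `[s, t]) phi x)%E) ->
  m <= M ->
  (`|clampr m M (F a) - clampr m M (F b)|%:E <=
     \int[leb]_(x in `[a, b]) (if (m < F x < M)%R then phi x else 0))%E.
Proof.
move=> ab mphi phi0 phioo hF mM.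
(* [F] is controlled on [a, b] only; extending it by constants gives a function continuous on the
   whole line, by absolute continuity of the integral of [phi]. *)
pose G := F \o clampr a b.
have Gab x : `[a, b]%classic x -> G x = F x.
  by rewrite /= in_itv/= => xab; rewrite /G/= clampr_id.
have cG : continuous G.
  move=> x; apply/cvgrPdist_lt => e e0.
  have [r r0 hr] := @integral_absolutely_continuous _ (measurableTypeR R) R leb _ _
     (measurable_itv _) mphi phi0 phioo e e0.
  near=> y; have xy : `|x - y| < r by near: y; apply: (nbhsx_ballx x r r0).
  have := clampr_contraction a b x y; rewrite /G/=.
  have := clampr_itv x ab; have := clampr_itv y ab.
  move: (clampr a b x) (clampr a b y) => x' y' /andP[ay yb] /andP[ax xb] xy'.
  wlog xley : x' y' ax xb ay yb xy' / x' <= y'.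
    move=> W; have [/W|/ltW/W] := leP x' y'; first exact.
    by rewrite distrC (distrC (F y')); apply.
  rewrite -lte_fin; apply: le_lt_trans (hF _ _ ax xley yb) _.
  apply: hr; [exact: measurable_itv|exact: subitvcc|].
  have E : leb `[x', y']%classic = (if x' < y' then (y' - x')%:E else 0%E).
    by rewrite lebesgue_measure_itv/= lte_fin -EFinB.
  apply: (@le_lt_trans _ _ (if x' < y' then (y' - x')%:E else 0%E)).
    by rewrite -E; exact: lexx.
  case: ifPn => _; last by rewrite lte_fin.
  by rewrite lte_fin; move: xy'; rewrite distrC ger0_norm ?subr_ge0//; move/le_lt_trans; apply.
have aab : `[a, b]%classic a by rewrite /= in_itv/= lexx.
have bab : `[a, b]%classic b by rewrite /= in_itv/= lexx andbT.
have hG s t : a <= s -> s <= t -> t <= b ->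
    (`|G s - G t|%:E <= \int[leb]_(x in `[s, t]) phi x)%E.
  move=> as' st tb; rewrite !Gab; first exact: hF.
    by rewrite /= in_itv/= tb (le_trans as').
  by rewrite /= in_itv/= as' (le_trans st).
rewrite -(Gab a)// -(Gab b)//.
rewrite [leRHS](_ : _ =
  (\int[leb]_(x in `[a, b]) (if (m < G x < M)%R then phi x else 0))%E); last first.
  by apply: eq_integral => x; rewrite inE => xab; rewrite Gab.
have [Tab|Tba|->] := ltgtP (clampr m M (G a)) (clampr m M (G b)); last 1 first.
- by rewrite subrr normr0; apply: integral_ge0 => x xab; case: ifP => // _; exact: phi0.
- rewrite distrC ger0_norm ?subr_ge0 ?(ltW Tab)//.
  exact: clamp_increment_lt.
rewrite ger0_norm ?subr_ge0 ?(ltW Tba)//.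
(* A decreasing increment is an increasing one of [- G], clamped between [- M] and [- m]. *)
have := @clamp_increment_lt (fun t => - G t) phi a b (- M) (- m).
rewrite !clamprN// opprK addrC ltrN2 lerN2.
under eq_integral do rewrite !ltrN2 andbC.
apply => //; first by move=> t; apply: cvgN; exact: cG.
by move=> s t as' st tb; rewrite -opprD normrN; exact: hG.
Unshelve. all: by end_near. Qed.

End crossing.

(** * Subcurves *)

Section curves.
Context {R : realType}.
Local Notation leb := (@lebesgue_measure R).

Lemma curve_length_shift {X : metricType R} (g : R -> X) (a b h : R) :
  curve_length a b (fun t => g (t + h)) = curve_length (a + h) (b + h) g.
Proof.
have K (f : R -> X) (a' b' k : R) :
    (curve_length a' b' (fun t => f (t + k)%R) <= curve_length (a' + k)%R (b' + k)%R f)%E.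
  apply: le_ereal_sup => _ [s sab <-]; exists (map (+%R^~ k) s).
    case: sab => ps /eqP ls; split; last by rewrite (last_map (+%R^~ k)) ls.
    elim: s a' ps {ls} => //= x s IH a' /andP[ax xs].
    by rewrite ltrD2r ax/=; exact: IH.
  congr (_%:E); rewrite /metric_variation size_map.
  apply: eq_big_nat => n /andP[_ ns].
  have E j : (j <= size s)%N -> nth (b' + k) (a' + k :: map (+%R^~ k) s) j = nth b' (a'
    :: s) j + k.
    by move=> js; exact: (nth_map b' (b' + k) (+%R^~ k) (s := a' :: s)).
  by rewrite /= -/(nth _ (a' + k :: _) n) E ?(ltnW ns)//; have := E n.+1 ns; rewrite /= => ->.
apply/eqP; rewrite eq_le K/=.
have := K (fun t => g (t + h)) (a + h) (b + h) (- h).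
rewrite !addrK; suff -> : (fun t => g (t - h + h)) = g by [].
by apply/funext => t; rewrite subrK.
Qed.

Section subcurve.
Context {X : metricType R} (c : curve X) (s t : R).
Hypotheses (s0 : 0 <= s) (st : s < t) (tl : t <= curve_len c).

Let subcurve_len_gt0 : 0 < t - s. Proof. by rewrite subr_gt0. Qed.

Let subcurve_continuous : {within `[0, t - s], continuous (fun r => c (r + s))}.
Proof.
apply/subspace_continuousP => x /= xts.
have xs : `[0, curve_len c]%classic (x + s).
  have := s0; have := tl.
  by move: xts; rewrite /= !in_itv/= => /andP[? ?] ? ?; apply/andP; split; lra.
have := (subspace_continuousP _ _).1 (@curve_continuous _ _ c) _ xs.
apply: cvg_trans => W /= H.
have : (fun r => r + s) @ x --> x + s by apply: cvgD; [exact: cvg_id|exact: cvg_cst].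
move=> xs_cvg.
suff : nbhs x [set y | `[0, t - s]%classic y -> W (c (y + s))] by [].
apply: (@filterS _ _ (nbhs_filter (x : R))) (xs_cvg _ H) => y hy yts; apply: hy.
have := s0; have := tl.
by move: yts; rewrite /= !in_itv/= => /andP[? ?] ? ?; apply/andP; split; lra.
Qed.

Let subcurve_arc_length : forall u v, 0 <= u -> u <= v -> v <= t - s ->
  curve_length u v (fun r => c (r + s)) = (v - u)%:E.
Proof.
move=> u v u0 uv vts; have := s0; have := tl => tl' s0'.
rewrite curve_length_shift curve_arc_length; [|lra..].
by congr (_%:E); lra.
Qed.

Definition subcurve : curve X :=
  Curve subcurve_len_gt0 subcurve_continuous subcurve_arc_length.

End subcurve.

Lemma line_integral_subcurve {d} {X : metricMeasurableType R d} (c : curve X) (s t : R)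
    (s0 : 0 <= s) (st : s < t) (tl : t <= curve_len c) (g : X -> \bar R) :
  measurable_fun `[0, curve_len c] (g \o c) ->
  (forall x, 0 <= g x)%E ->
  line_integral (subcurve s0 st tl) g =
  (\int[leb]_(r in `[s, t]) g (c r))%E.
Proof.
move=> mg g0; rewrite /line_integral/=.
pose phi (r : measurableTypeR R) : measurableTypeR R := r + s.
have mphi : measurable_fun setT phi by apply: measurable_funD.
(* Translation invariance: the image measure agrees with Lebesgue measure on half-open intervals,
   which determine it. *)
have leb_phi A : measurable A -> pushforward leb phi A = leb A.
  move=> mA; apply/esym/lebesgue_measure_unique => //= _ [[a b]] _ <-.
  rewrite /pushforward.
  have -> : phi @^-1` `]a, b] = `]a - s, b - s]%classic.
    by apply/seteqP; split => x /=; rewrite !in_itv/= /phi ltrBlDr lerBrDr.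
  rewrite !lebesgue_measure_itv/= !lte_fin ltrD2r; case: ifP => // _.
  by rewrite -!EFinB; congr (_%:E); lra.
have -> : `[0, t - s]%classic = phi @^-1` `[s, t]%classic.
  by apply/seteqP; split => x /=; rewrite !in_itv/= /phi lerBrDr; case: (_ <= t);
    rewrite ?andbT ?andbF// => ?; lra.
rewrite -(@ge0_integral_pushforward _ _ (measurableTypeR R) (measurableTypeR R) R phi
  mphi leb `[s, t]%classic (g \o c))//=.
- by apply: eq_measure_integral => //= A mA _; exact: leb_phi.
- by apply: measurable_funS mg => //; exact: subitvcc.
Qed.

(** A continuous curve pulls Borel sets back to Borel sets, whereas the preimage of a general null
    set of the completion is uncontrolled. The curve is first extended by constants to the whole
    line. *)
Lemma borel_curve_measurable {d} {X : metricMeasurableType R d} (c : curve X) (g : X ->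
  \bar R) :
  (forall r : R, <<s @open X >> [set x | (r%:E < g x)%E]) ->
  measurable_fun `[0, curve_len c] (g \o c).
Proof.
move=> bg; pose l := curve_len c; pose c' := c \o clampr 0 l.
have l0 : 0 <= l by exact: ltW (curve_len_gt0 c).
have cc' : continuous c'.
  move=> x; have := (subspace_continuousP _ _).1 (@curve_continuous _ _ c).
  have xl : `[0, l]%classic (clampr 0 l x) by rewrite /= in_itv/= clampr_itv.
  move=> /(_ _ xl); apply: cvg_trans => W /= H.
  suff : nbhs x (c' @^-1` W) by [].
  apply: (@filterS _ _ (nbhs_filter (x : R))) (@continuous_clampr _ 0 l x _ H) => y hy;
    apply: hy.
  by rewrite /= in_itv/= clampr_itv.
have mc' (B : set X) : <<s @open X >> B -> measurable (c' @^-1` B).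
  move=> sB; pose G := [set B : set X | measurable (c' @^-1` B)].
  suff : <<s @open X >> `<=` G by apply.
  apply: smallest_sub.
    split => /=; first by rewrite /G/= preimage_set0.
    - by move=> A GA; rewrite /G/= setTD preimage_setC; exact: measurableC.
    - by move=> A GA; rewrite /G/= preimage_bigcup; exact: bigcupT_measurable.
  by move=> U oU; apply: open_measurable; apply: (continuousP c').1.
move=> mD; apply: (measurability _ (ErealGenOInfty.measurableE R)) => //.
move=> _ [_ [r ->] <-].
have -> : `[0, curve_len c] `&` (g \o c) @^-1` `]r%:E, +oo[%classic =
    `[0, curve_len c] `&` c' @^-1` [set x | (r%:E < g x)%E].
  apply/seteqP; split => x [xl hx]; (split; first exact: xl);
  have E : c' x = c x by rewrite /c'/= clampr_id//; move: xl; rewrite /= in_itv.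
  - by move: hx; rewrite /preimage/= in_itv/= andbT E.
  - by move: hx; rewrite /preimage/= in_itv/= andbT E.
by apply: measurableI => //; exact: mc'.
Qed.

End curves.

Lemma ereal_rat_between {R : realType} (r : R) (y : \bar R) : (r%:E < y)%E ->
  exists q : rat, r < ratr q /\ ((ratr q)%:E < y)%E.
Proof.
case: y => [y| |]// ry; last first.
- have /rat_in_itvoo[q] : r < r + 1 by rewrite ltrDl.
  by rewrite in_itv/= => /andP[rq _]; exists q; rewrite ltry.
- have /rat_in_itvoo[q] : r < y by [].
  by rewrite in_itv/= => /andP[rq qy]; exists q; rewrite lte_fin.
Qed.

(** * Curve-measurable majorants and exceptional families *)

(* The line integral of a merely measurable function is a lower integral; it is
   additive and satisfies convergence theorems on the functions below, and every
   nonnegative measurable function has such a majorant in its a.e. class. *)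
Definition curve_measurable {R : realType} {d : measure_display}
    {X : metricMeasurableType R d} (g : X -> \bar R) : Prop :=
  nonneg_measurable g /\
  forall c : curve X, measurable_fun `[0, curve_len c] (g \o c).

Section completeness.
Context {R : realType} {d : measure_display} {X : metricMeasurableType R d}.
Variable mu : {measure set X -> \bar R}.
Hypothesis mu_borel : complete_borel mu.

(** A null set of the completion is a Borel set together with a part of a null Borel set, so it is
    contained in a null Borel set, and so are all its subsets. *)
Lemma complete_borel_complete : measure_is_complete mu.
Proof.
move=> N [B [mB B0 NB]].
have : completed_algebra_gen (mu : set (g_sigma_algebraType (@open X)) -> \bar R) B.
  by rewrite -mu_borel.
move=> [B0' mB0' [N0 [M0 [mM0 M00 NM0]] BE]].
have mB0d : d.-measurable B0'.
  rewrite mu_borel; exists B0' => //; exists set0; last by rewrite setU0.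
  by exists set0; split => //; exact: measure0.
rewrite mu_borel; exists set0; first exact: measurable0.
exists N; last by rewrite set0U.
exists (B0' `|` M0); split.
- exact: measurableU.
- have mM0d : d.-measurable M0.
    rewrite mu_borel; exists M0 => //; exists set0; last by rewrite setU0.
    by exists set0; split => //; exact: measure0.
  apply/eqP; rewrite -measure_le0; apply: le_trans (measureU2 _ _ _) _ => //.
  have le0 : (mu M0 <= 0)%E by rewrite le_eqVlt; apply/orP; left; apply/eqP; exact: M00.
  apply: le_trans (leeD2l _ le0) _; rewrite adde0 -B0; apply: le_measure; rewrite ?inE//.
  by rewrite -BE; exact: subsetUl.
- by move=> x /NB; rewrite -BE => -[xB|/NM0 xM]; [left|right].
Qed.

Lemma measurable_modification (N : set X) (f g : X -> \bar R) :
  mu.-negligible N -> (forall x, ~ N x -> g x = f x) ->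
  measurable_fun setT f -> measurable_fun setT g.
Proof.
move=> negN fg; apply: (ae_measurable_fun complete_borel_complete).
by apply: negligibleS negN => x /= h; apply: contrapT => /fg gf; apply: h.
Qed.

(** Each superlevel set of [g] at a rational level is Borel outside a null Borel set. Outside the
    countable union [M] of these exceptions all superlevel sets are unions of rational ones, hence
    Borel. *)
Lemma borel_majorant (g : X -> \bar R) : nonneg_measurable g ->
  exists g', [/\ curve_measurable g', forall x, (g x <= g' x)%E &
    {ae mu, forall x, g' x = g x}].
Proof.
move=> [g0 mg]; pose Y := g_sigma_algebraType (@open X).
have H (q : rat) : exists BM : set X * set X,
    [/\ @measurable _ Y BM.1, @measurable _ Y BM.2, mu BM.2 = 0%E &
      forall x, ~ BM.2 x -> ((ratr q)%:E < g x)%E <-> BM.1 x].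
  have : completed_algebra_gen (mu : set Y -> \bar R) [set x | ((ratr q)%:E < g x)%E].
    rewrite -mu_borel; have := emeasurable_fun_o_infty measurableT mg (ratr q)%:E.
    by rewrite setTI.
  move=> [B mB [N [M [mM M0 NM]] BE]]; exists (B, M); split => //= x nMx.
  split => [|xB]; last first.
    have : (B `|` N) x by left.
    by rewrite BE.
  move=> h; have : (B `|` N) x by rewrite BE.
  by move=> [//|/NM].
have {H}[BM hBM] := choice H.
pose M := \bigcup_q (BM q).2.
have mM : @measurable _ Y M by apply: bigcupT_measurable_rat => q; have [] := hBM q.
have mBorel B : @measurable _ Y B -> d.-measurable B.
  move=> mB; rewrite mu_borel; exists B => //; exists set0; last by rewrite setU0.
  by exists set0; split => //; exact: measure0.
have M0 : mu.-negligible M.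
  have -> : M = \bigcup_n (BM (odflt 0 (choice.unpickle n))).2.
    apply/seteqP; split => x [q _ xq]; last by exists (odflt 0 (choice.unpickle q)).
    by exists (choice.pickle q) => //; rewrite choice.pickleK.
  apply: negligible_bigcup => n; have [_ mM' M0 _] := hBM (odflt 0 (choice.unpickle n)).
  by apply/negligibleP => //; exact: mBorel.
(* The value +oo puts all of [M] into every superlevel set at a real level, which keeps these sets
   Borel and makes the modification a majorant. *)
pose g' x := if `[< M x >] then +oo%E else g x.
have g'E x : ~ M x -> g' x = g x by move=> nMx; rewrite /g' asboolF.
exists g'; split; last 2 first.
- by move=> x; rewrite /g'; case: ifP => // _; rewrite leey.
- by apply: negligibleS M0 => x /= h; apply: contrapT => /g'E.
split; first split.
- by move=> x; rewrite /g'; case: ifP => // _; rewrite leey.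
- exact: measurable_modification M0 g'E mg.
move=> c; apply: borel_curve_measurable => r.
suff : @measurable _ Y [set x | (r%:E < g' x)%E] by [].
have -> : [set x | (r%:E < g' x)%E] =
    M `|` \bigcup_(q in [set q : rat | r < ratr q]) (BM q).1.
  apply/seteqP; split => x /=.
    have [Mx|nMx] := pselect (M x); first by left.
    rewrite g'E// => /ereal_rat_between[q [rq qg]]; right; exists q => //.
    have [_ _ _ /(_ x) [|+ _]] := hBM q; last exact.
    by move=> Mx; apply: nMx; exists q.
  have [Mx _|nMx [//|[q /= rq Bq]]] := pselect (M x).
    by rewrite /g' asboolT// ltry.
  rewrite g'E// (lt_trans (_ : (r%:E < (ratr q)%:E)%E))//.
  have [_ _ _ /(_ x) [|_]] := hBM q; last exact.
  by move=> Mx; apply: nMx; exists q.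
apply: measurableU => //; rewrite bigcup_mkcond; apply: bigcupT_measurable_rat => q.
by case: ifP => // _; have [] := hBM q.
Qed.

End completeness.

Section densities.
Context {R : realType} {d : measure_display} {X : metricMeasurableType R d}.
Variables (mu : {measure set X -> \bar R}) (p : R).
Hypothesis p0 : 0 < p.
Local Open Scope ereal_scope.

Lemma poweR_le (x y : \bar R) : 0 <= x -> x <= y -> x `^ p <= y `^ p.
Proof.
move=> x0 xy; apply: gt0_ler_poweR => //; first exact: ltW.
  by rewrite in_itv/= x0 leey.
by rewrite in_itv/= leey (le_trans x0).
Qed.

Lemma int_powE (g : X -> \bar R) : (forall x, 0 <= g x) ->
  int_pow mu p g = \int[mu]_x (g x `^ p).
Proof. by move=> g0; apply: eq_integral => x _; rewrite gee0_abs. Qed.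

Lemma int_pow_ge0 (g : X -> \bar R) : 0 <= int_pow mu p g.
Proof. by apply: integral_ge0 => x _; exact: poweR_ge0. Qed.

Lemma int_pow_le (f g : X -> \bar R) :
  (forall x, 0 <= f x) -> (forall x, f x <= g x) ->
  int_pow mu p f <= int_pow mu p g.
Proof.
move=> f0 fg; have g0 x : 0 <= g x by exact: le_trans (fg x).
rewrite !int_powE//; apply: ge0_le_lower_integral => x _; first exact: poweR_ge0.
exact: poweR_le.
Qed.

Lemma measurable_int_pow (g : X -> \bar R) : measurable_fun setT g ->
  measurable_fun setT (fun x => g x `^ p).
Proof. by move=> mg; apply: (measurableT_comp (measurable_poweR p)). Qed.

Lemma ae_int_pow_le (f g : X -> \bar R) : nonneg_measurable f -> nonneg_measurable g ->
  {ae mu, forall x, f x <= g x} -> int_pow mu p f <= int_pow mu p g.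
Proof.
move=> [f0 mf] [g0 mg] fg; rewrite !int_powE//.
apply: ae_ge0_le_integral => //.
- by move=> x _; exact: poweR_ge0.
- exact: measurable_int_pow.
- by move=> x _; exact: poweR_ge0.
- exact: measurable_int_pow.
- by apply: filterS fg => x fgx _; exact: poweR_le.
Qed.

Lemma int_powZ (k : R) (g : X -> \bar R) : (0 <= k)%R -> nonneg_measurable g ->
  int_pow mu p (fun x => k%:E * g x) = (k `^ p)%:E * int_pow mu p g.
Proof.
move=> k0 [g0 mg]; rewrite !int_powE//; last by move=> x; rewrite mule_ge0.
rewrite -ge0_integralZl//.
- by apply: eq_integral => x _; rewrite poweRM// poweR_EFin.
- exact: measurable_int_pow.
- by move=> x _; exact: poweR_ge0.
- by rewrite lee_fin powR_ge0.
Qed.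

Lemma line_integral_ge0 (c : curve X) (g : X -> \bar R) :
  (forall x, 0 <= g x) -> 0 <= line_integral c g.
Proof. by move=> g0; apply: integral_ge0. Qed.

Lemma line_integral_le (c : curve X) (f g : X -> \bar R) :
  (forall x, 0 <= f x) -> (forall x, f x <= g x) ->
  line_integral c f <= line_integral c g.
Proof. by move=> f0 fg; apply: ge0_le_lower_integral. Qed.

Lemma line_integralZ (c : curve X) (k : R) (g : X -> \bar R) :
  (0 <= k)%R -> curve_measurable g ->
  line_integral c (fun x => k%:E * g x) = k%:E * line_integral c g.
Proof.
move=> k0 [[g0 _] mg]; rewrite /line_integral.
by rewrite -ge0_integralZl//; exact: mg.
Qed.

Lemma curve_measurable_esups (f : nat -> X -> \bar R) :
  (forall n, curve_measurable (f n)) ->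
  curve_measurable (fun x => ereal_sup (range (fun n => f n x))).
Proof.
move=> mf; have E T (h : nat -> T -> \bar R) :
    (fun x => ereal_sup (range (fun n => h n x))) = (fun x => esups (h ^~ x) 0%N).
  apply/funext => x; rewrite /esups/sdrop; congr ereal_sup.
  by apply/seteqP; split => _ [n _ <-]; exists n.
split; first split.
- by move=> x; apply: le_trans ((mf 0%N).1.1 x) _; apply: ereal_sup_ubound; exists 0%N.
- by rewrite E; apply: measurable_fun_esups => n; exact: (mf n).1.2.
- move=> c; rewrite /comp (E _ (fun n => f n \o c)).
  by apply: measurable_fun_esups => n; exact: (mf n).2.
Qed.

(** The p-th power of a supremum is at most the sum of the p-th powers. Combining functions by
    suprema instead of sums thus avoids the triangle inequality in L^p. *)
Lemma int_pow_esups (f : nat -> X -> \bar R) :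
  (forall n, nonneg_measurable (f n)) ->
  int_pow mu p (fun x => ereal_sup (range (fun n => f n x))) <=
  \sum_(n <oo) int_pow mu p (f n).
Proof.
move=> mf; have f0 n x := (mf n).1 x.
have s0 x : 0 <= ereal_sup (range (fun n => f n x)).
  by apply: le_trans (f0 0%N x) _; apply: ereal_sup_ubound; exists 0%N.
rewrite int_powE//.
rewrite (_ : \sum_(n <oo) _ = \int[mu]_x (\sum_(n <oo) (f n x `^ p))); last first.
  rewrite integral_nneseries//.
  - by apply: eq_eseriesr => n _; rewrite int_powE.
  - by move=> n; exact/measurable_int_pow/(mf n).2.
  - by move=> n x _; exact: poweR_ge0.
apply: ge0_le_lower_integral => x _; first exact: poweR_ge0.
set S := \sum_(n <oo) _.
have fS n : f n x `^ p <= S.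
  rewrite /S (@nneseriesD1 _ _ n)//; last by move=> k _; exact: poweR_ge0.
  by apply: leeDl; apply: nneseries_ge0 => k _ _; exact: poweR_ge0.
have S0 : 0 <= S by apply: le_trans (fS 0%N); exact: poweR_ge0.
have pV : (p^-1 * p = 1)%R by rewrite mulVf// gt_eqF.
have fSp n : f n x <= S `^ p^-1.
  rewrite -[leLHS](@poweRe1 _ (f n x))// -(@mulfV _ p) ?gt_eqF// poweRrM.
  apply: gt0_ler_poweR; rewrite ?invr_ge0 ?(ltW p0)// in_itv/= ?poweR_ge0 ?leey//.
  by rewrite S0.
rewrite -[leRHS](poweRe1 S0) -pV poweRrM; apply: poweR_le => //.
by apply: ge_ereal_sup => _ [n _ <-].
Qed.

(** A witness that a family of curves is exceptional. A condition of the form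
    [line_integral c rho < +oo] below reads: for almost every curve [c]. *)
Definition density (rho : X -> \bar R) : Prop :=
  curve_measurable rho /\ int_pow mu p rho < +oo.

Lemma density_scale (rho : X -> \bar R) (e : R) : density rho -> (0 < e)%R ->
  exists2 k : R, (0 < k)%R & curve_measurable (fun x => k%:E * rho x) /\
    int_pow mu p (fun x => k%:E * rho x) <= e%:E.
Proof.
move=> [[[rho0 mrho] crho] rhooo] e0.
have Ifin : int_pow mu p rho \is a fin_num by rewrite ge0_fin_numE// int_pow_ge0.
have I0 : (0 <= fine (int_pow mu p rho))%R by rewrite fine_ge0// int_pow_ge0.
(* The summand 1 keeps the denominator positive when the energy of [rho] is 0. *)
pose s := (e / (fine (int_pow mu p rho) + 1))%R.
have s0 : (0 < s)%R by rewrite divr_gt0// ltr_wpDl.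
exists (s `^ p^-1)%R; first exact: powR_gt0.
split.
  split; first (split; first by move=> x; rewrite mule_ge0// lee_fin powR_ge0).
    exact: emeasurable_funM.
  by move=> c; apply: emeasurable_funM => //; exact: crho.
rewrite int_powZ ?powR_ge0// -powRrM mulVf ?gt_eqF// powRr1 ?(ltW s0)//.
rewrite -(fineK Ifin) -EFinM lee_fin /s -mulrA mulrC -[leRHS]mul1r ler_wpM2r ?(ltW e0)//.
by rewrite mulrC ler_pdivrMr ?mul1r ?lerDl ?ltr_wpDl.
Qed.

(** This is the source of countable subadditivity of exceptional families: scale the n-th function
    to energy at most 2^-(n+1) and take the supremum. The pointwise bound with explicit factors is
    kept for functions that are only locally in L^p. *)
Lemma density_seq (rho_ : nat -> X -> \bar R) : (forall n, density (rho_ n)) ->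
  exists2 rho, density rho & exists2 k : nat -> R, (forall n, 0 < k n)%R &
    forall n x, (k n)%:E * rho_ n x <= rho x.
Proof.
move=> drho.
have H n : exists k : R, [/\ (0 < k)%R, curve_measurable (fun x => k%:E * rho_ n x) &
    int_pow mu p (fun x => k%:E * rho_ n x) <= (1 / (2 ^ n.+1)%:R)%:E].
  have [|k k0 [? ?]] := @density_scale (rho_ n) (1 / (2 ^ n.+1)%:R) (drho n); last by exists k.
  by rewrite divr_gt0// ltr0n expn_gt0.
have {H}[k hk] := choice H.
exists (fun x => ereal_sup (range (fun n => (k n)%:E * rho_ n x))); last first.
  exists k; first by move=> n; have [] := hk n.
  by move=> n x; apply: ereal_sup_ubound; exists n.
split.
  by apply: (@curve_measurable_esups (fun n x => (k n)%:E * rho_ n x)) => n; have [] := hk n.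
apply: le_lt_trans (@int_pow_esups (fun n x => (k n)%:E * rho_ n x) _) _.
  by move=> n; have [_ []] := hk n.
apply: (@le_lt_trans _ _ 1%:E); last exact: ltry.
apply: le_trans (@epsilon_trick0 R 1 xpredT ler01).
apply: lee_nneseries => n *; first exact: int_pow_ge0.
by have [] := hk n.
Qed.

Lemma density_seq_line_integral (rho_ : nat -> X -> \bar R) : (forall n, density (rho_ n)) ->
  exists2 rho, density rho & forall c : curve X, line_integral c rho < +oo ->
    forall n, line_integral c (rho_ n) < +oo.
Proof.
move=> drho; have [rho drho' [k k0 hk]] := density_seq drho.
exists rho => // c cfin n.
have rho0 x : 0 <= rho_ n x by exact: (drho n).1.1.1.
have : line_integral c (fun x => (k n)%:E * rho_ n x) < +oo.
  apply: le_lt_trans cfin; apply: line_integral_le => // x.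
  by rewrite mule_ge0// lee_fin ltW.
rewrite line_integralZ ?ltW//; last exact: (drho n).1.
have := line_integral_ge0 c rho0; case: line_integral => [r _ _|_|//]; first exact: ltry.
by rewrite gt0_muley ?lte_fin.
Qed.

Lemma density_pair (rho1 rho2 : X -> \bar R) : density rho1 -> density rho2 ->
  exists2 rho, density rho & forall c : curve X, line_integral c rho < +oo ->
    line_integral c rho1 < +oo /\ line_integral c rho2 < +oo.
Proof.
move=> d1 d2; have [|rho drho h] :=
  @density_seq_line_integral (fun n => if n is 0%N then rho1 else rho2).
  by case.
by exists rho => // c /h hc; split; [exact: (hc 0%N)|exact: (hc 1%N)].
Qed.

End densities.

(** * Calculus of weak upper gradients *)

(** Truncation of an extended value to real bounds is real, so truncations can be added and scaled
    in [R], even where [u] is infinite. *)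
Definition eclamp {R : realType} (m M : R) (e : \bar R) : R :=
  fine (maxe m%:E (mine e M%:E)).

Section eclamp.
Context {R : realType}.
Implicit Types (m M : R) (e : \bar R).

Lemma eclampE m M e : m <= M -> (eclamp m M e)%:E = maxe m%:E (mine e M%:E).
Proof.
move=> mM; rewrite /eclamp fineK//; case: e => [r| |].
- by rewrite -EFin_min -EFin_max.
- by rewrite minye -EFin_max.
- by rewrite minNye maxeNy.
Qed.

Lemma eclamp_fin m M (r : R) : eclamp m M r%:E = clampr m M r.
Proof. by rewrite /eclamp -EFin_min -EFin_max. Qed.

Lemma eclamp_itv m M e : m <= M -> m <= eclamp m M e <= M.
Proof.
move=> mM; rewrite -!lee_fin eclampE// le_max lexx/= ge_max lee_fin mM/=.
by rewrite ge_min lexx orbT.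
Qed.

Lemma eclamp_le m M e : m <= M -> (e <= m%:E)%E -> eclamp m M e = m.
Proof.
move=> mM em; apply/EFin_inj; rewrite eclampE// min_l ?max_l//.
by rewrite (le_trans em)// lee_fin.
Qed.

Lemma eclamp_ge m M e : m <= M -> (M%:E <= e)%E -> eclamp m M e = M.
Proof.
by move=> mM em; apply/EFin_inj; rewrite eclampE// min_r ?max_r// lee_fin.
Qed.

End eclamp.

Lemma measurable_eclamp {R : realType} {d : measure_display} {T : measurableType d}
    (f : T -> \bar R) (m M : R) : m <= M -> measurable_fun setT f ->
  measurable_fun setT (fun x => (eclamp m M (f x))%:E).
Proof.
move=> mM mf; under eq_fun do rewrite eclampE//.
apply: measurable_maxe => //; exact: measurable_mine.
Qed.

Lemma abseB_lty_fin {R : realType} (x y : \bar R) : (`|x - y| < +oo)%E ->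
  x \is a fin_num /\ y \is a fin_num.
Proof. by case: x => [r| |]; case: y. Qed.

Section upper_gradients.
Context {R : realType} {d : measure_display} {X : metricMeasurableType R d}.
Variables (mu : {measure set X -> \bar R}) (p : R).
Hypotheses (p0 : 0 < p) (mu_borel : complete_borel mu).
Local Open Scope ereal_scope.
Local Notation leb := (@lebesgue_measure R).

Lemma exceptional_density (Gamma : set (curve X)) : exceptional mu p Gamma ->
  exists2 rho, density mu p rho & forall c, line_integral c rho < +oo -> ~ Gamma c.
Proof.
move=> [rho [nrho rhooo hrho]].
have [rho' [crho' le_rho ae_rho]] := borel_majorant mu_borel nrho.
exists rho'.
  split => //; apply: le_lt_trans rhooo; apply: ae_int_pow_le => //; first exact: crho'.1.
  by apply: filterS ae_rho => x ->.
move=> c cfin /hrho cinf; move: cfin; apply/negP; rewrite -leNgt -cinf.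
by apply: line_integral_le => //; exact: nrho.1.
Qed.

Lemma wug_density (f g : X -> \bar R) : weak_upper_gradient mu p f g ->
  exists2 rho, density mu p rho & forall c : curve X, line_integral c rho < +oo ->
    `|f (c 0%R) - f (c (curve_len c))| <= line_integral c g.
Proof.
move=> [_ [Gamma /exceptional_density[rho drho hrho] h]].
by exists rho => // c /hrho; exact: h.
Qed.

Lemma density_wug (f g rho : X -> \bar R) : nonneg_measurable g -> density mu p rho ->
  (forall c : curve X, line_integral c rho < +oo ->
    `|f (c 0%R) - f (c (curve_len c))| <= line_integral c g) ->
  weak_upper_gradient mu p f g.
Proof.
move=> ng [crho rhooo] h; split => //.
exists [set c | line_integral c rho = +oo]; first by exists rho; split => //; exact: crho.1.
by move=> c /= /eqP hc; apply: h; rewrite ltey.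
Qed.

Lemma wug_le (f g g' : X -> \bar R) : weak_upper_gradient mu p f g ->
  (forall x, g x <= g' x) -> nonneg_measurable g' -> weak_upper_gradient mu p f g'.
Proof.
move=> [[g0 _] [Gamma eG h]] gg' ng'; split => //; exists Gamma => // c /h.
by move=> /le_trans; apply; exact: line_integral_le.
Qed.

(** Absolute continuity of [f] along almost every curve, with [g] as a bound for the derivative,
    stated without derivatives. *)
Definition controls (f g : X -> \bar R) : Prop :=
  curve_measurable g /\
  exists2 rho, density mu p rho & forall c : curve X, line_integral c rho < +oo ->
    [/\ line_integral c g < +oo,
      forall t, `[0%R, curve_len c]%classic t -> f (c t) \is a fin_num &
      forall s t, (0 <= s)%R -> (s <= t)%R -> (t <= curve_len c)%R ->
        `|fine (f (c s)) - fine (f (c t))|%:E <= \int[leb]_(r in `[s, t]) g (c r)].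

(* Subcurves of a curve outside an exceptional family are outside it too, so the
   upper gradient inequality holds between any two points of the curve. *)
Lemma wug_controls (f g rho1 : X -> \bar R) : weak_upper_gradient mu p f g ->
  curve_measurable g -> density mu p rho1 ->
  (forall c : curve X, line_integral c rho1 < +oo -> line_integral c g < +oo) ->
  controls f g.
Proof.
move=> /wug_density[rho0 drho0 h0] cg drho1 h1; split => //.
have [rho drho hrho] := density_pair p0 drho0 drho1; exists rho => // c /hrho[c0 c1].
have g0 := cg.1.1; have gc := h1 c c1.
have H s t : (0 <= s)%R -> (s < t)%R -> (t <= curve_len c)%R ->
    `|f (c s) - f (c t)| <= \int[leb]_(r in `[s, t]) g (c r).
  move=> s0 st tl; have /= := h0 (subcurve s0 st tl).
  have [[r0 _] mr] := drho0.1; have mg := cg.2 c.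
  rewrite add0r subrK !line_integral_subcurve//.
  apply; apply: le_lt_trans c0; apply: ge0_subset_lower_integral.
    exact: subitvcc.
  by move=> x _; exact: r0.
have Hoo s t : (0 <= s)%R -> (s < t)%R -> (t <= curve_len c)%R ->
    \int[leb]_(r in `[s, t]) g (c r) < +oo.
  move=> s0 st tl; apply: le_lt_trans gc; apply: ge0_subset_lower_integral => //.
  exact: subitvcc.
have l0 := curve_len_gt0 c.
(* Every point is an endpoint of a subcurve along which [g] has finite integral; an infinite value
   of [f] there would make the left-hand side +oo. *)
have fin t : `[0%R, curve_len c]%classic t -> f (c t) \is a fin_num.
  rewrite /= in_itv/= => /andP[t0 tl].
  have [tltl|lelt] := ltP t (curve_len c).
    by have [] := abseB_lty_fin (le_lt_trans (H t _ t0 tltl (lexx _)) (Hoo t _ t0 tltl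
      (lexx _))).
  have tE : t = curve_len c by apply/eqP; rewrite eq_le tl.
  by rewrite tE; have [] := abseB_lty_fin (le_lt_trans (H _ _ (lexx _) l0 (lexx _))
    (Hoo _ _ (lexx _) l0 (lexx _))).
split => // s t s0 st tl.
have [stE|stN] := eqVneq s t.
  by rewrite stE subrr normr0; apply: integral_ge0.
have sltt : (s < t)%R by rewrite lt_neqAle stN.
rewrite -[leLHS]/(`|(fine (f (c s)) - fine (f (c t)))%:E|) EFinB !fineK; [exact: H| |];
  apply: fin; rewrite /= in_itv/=.
  by rewrite tl (le_trans s0).
by rewrite s0 (le_trans st).
Qed.

Lemma density_wug_controls (f g : X -> \bar R) : weak_upper_gradient mu p f g ->
  density mu p g -> controls f g.
Proof. by move=> fg dg; apply: (wug_controls fg dg.1 dg). Qed.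

Lemma wug_density_majorant (f g : X -> \bar R) : weak_upper_gradient mu p f g ->
  int_pow mu p g < +oo ->
  exists g', [/\ density mu p g', weak_upper_gradient mu p f g',
    int_pow mu p g' = int_pow mu p g & {ae mu, forall x, g' x = g x}].
Proof.
move=> fg goo; have ng := fg.1.
have [g' [cg' gg' aeg]] := borel_majorant mu_borel ng.
have E : int_pow mu p g' = int_pow mu p g.
  apply/eqP; rewrite eq_le; apply/andP; split; last by apply: int_pow_le => //; exact: ng.1.
  apply: ae_int_pow_le => //; first exact: cg'.1.
  by apply: filterS aeg => x ->.
exists g'; split => //; first by split => //; rewrite E.
by apply: wug_le fg gg' cg'.1.
Qed.

Lemma curve_measurable_min (g1 g2 : X -> \bar R) : curve_measurable g1 ->
  curve_measurable g2 -> curve_measurable (fun x => mine (g1 x) (g2 x)).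
Proof.
move=> [[p1 m1] c1] [[p2 m2] c2]; split; first split.
- by move=> x; rewrite le_min p1//= p2.
- exact: measurable_mine.
- by move=> c; apply: measurable_mine; [exact: c1|exact: c2].
Qed.

Lemma controls_min (f g1 g2 : X -> \bar R) : controls f g1 -> controls f g2 ->
  weak_upper_gradient mu p f (fun x => mine (g1 x) (g2 x)).
Proof.
move=> [cg1 [rho1 d1 h1]] [cg2 [rho2 d2 h2]].
have [rho drho hrho] := density_pair p0 d1 d2.
apply: (density_wug _ drho); first exact: (curve_measurable_min cg1 cg2).1.
move=> c /hrho[/h1[f1 fin H1] /h2[f2 _ H2]].
have l0 := ltW (curve_len_gt0 c).
rewrite -(fineK (fin 0%R _)); last by rewrite /= in_itv/= lexx.
rewrite -(fineK (fin (curve_len c) _)); last by rewrite /= in_itv/= lexx andbT.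
apply: (@min_increment_bound _ (fun t => fine (f (c t))) (g1 \o c) (g2 \o c)) => //.
- exact: cg1.2.
- exact: cg2.2.
- by move=> x _; exact: cg1.1.1.
- by move=> x _; exact: cg2.1.1.
Qed.

(** The truncation moves only while [f] is strictly between the levels. This takes the place of the
    fact that minimal gradients vanish a.e. on level sets. *)
Lemma controls_eclamp (f g : X -> \bar R) (m M : R) : measurable_fun setT f ->
  controls f g -> (m <= M)%R ->
  weak_upper_gradient mu p (fun x => (eclamp m M (f x))%:E)
    (fun x => if (m%:E < f x < M%:E) then g x else 0).
Proof.
move=> mf [cg [rho drho h]] mM; have g0 := cg.1.1.
apply: (density_wug _ drho).
  split; first by move=> x; case: ifP.
  apply: measurable_fun_ifT => //; last exact: cg.1.2.
  by apply: measurable_and; apply: measurable_fun_lte.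
move=> c /h[goo fin H]; have l0 := ltW (curve_len_gt0 c).
have E t : `[0%R, curve_len c]%classic t -> f (c t) = (fine (f (c t)))%:E.
  by move=> /fin/fineK.
rewrite E; last by rewrite /= in_itv/= lexx.
rewrite (E (curve_len c)); last by rewrite /= in_itv/= lexx andbT.
rewrite !eclamp_fin.
apply: le_trans (@clamp_increment_bound _ (fun t => fine (f (c t))) (g \o c)
  _ _ m M l0 _ _ goo H mM) _.
- exact: cg.2.
- by move=> x _; exact: g0.
apply: ge0_le_lower_integral => t tl; first by case: ifP => // _; exact: g0.
by rewrite (E t tl) !lte_fin.
Qed.

Lemma wug_lincomb (f1 f2 : X -> R) (g1 g2 : X -> \bar R) (k1 k2 : R) :
  (0 <= k1)%R -> (0 <= k2)%R ->
  weak_upper_gradient mu p (EFin \o f1) g1 -> curve_measurable g1 ->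
  weak_upper_gradient mu p (EFin \o f2) g2 -> curve_measurable g2 ->
  weak_upper_gradient mu p (fun x => (k1 * f1 x + k2 * f2 x)%:E)
    (fun x => k1%:E * g1 x + k2%:E * g2 x) /\
  curve_measurable (fun x => k1%:E * g1 x + k2%:E * g2 x).
Proof.
move=> k10 k20 /wug_density[rho1 d1 h1] cg1 /wug_density[rho2 d2 h2] cg2.
have p1 := cg1.1.1; have p2 := cg2.1.1.
have cg : curve_measurable (fun x => k1%:E * g1 x + k2%:E * g2 x).
  split; first split.
  - by move=> x; rewrite adde_ge0// mule_ge0.
  - by apply: emeasurable_funD; apply: emeasurable_funM => //; [exact: cg1.1.2|exact: cg2.1.2].
  - by move=> c; apply: emeasurable_funD; apply: emeasurable_funM => //;
    [exact: cg1.2|exact: cg2.2].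
split => //; have [rho drho hrho] := density_pair p0 d1 d2.
apply: (density_wug cg.1 drho) => c /hrho[/h1 H1 /h2 H2].
rewrite /line_integral ge0_integralD//.
- rewrite !ge0_integralZl//; [|exact: cg2.2|exact: cg1.2].
  apply: (@le_trans _ _ (k1%:E * `|(f1 (c 0%R) - f1 (c (curve_len c)))%:E| +
     k2%:E * `|(f2 (c 0%R) - f2 (c (curve_len c)))%:E|)); last first.
    by apply: leeD; apply: lee_wpmul2l.
  rewrite -!EFinM -!EFinD lee_fin.
  rewrite -[X in (_ <= X * _ + _)%R](ger0_norm k10) -[X in (_ <= _ + X * _)%R](ger0_norm k20).
  rewrite -!normrM.
  by apply: le_trans (ler_normD _ _); rewrite le_eqVlt; apply/orP; left; apply/eqP;
    congr `|_|%R; ring.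
- by move=> x _; rewrite mule_ge0.
- by apply: emeasurable_funM => //; exact: cg1.2.
- by move=> x _; rewrite mule_ge0.
- by apply: emeasurable_funM => //; exact: cg2.2.
Qed.

End upper_gradients.

(** * Existence of minimal weak upper gradients *)

Section countable_cover.
Context {R : realType} {d : measure_display} {X : metricMeasurableType R d}.
Variable mu : {measure set X -> \bar R}.
Hypothesis mu_borel : complete_borel mu.

Lemma open_metric_ball (x : X) (r : R) : open (ball x r).
Proof.
rewrite openE => y; rewrite ballEmdist/= => xyr.
apply/nbhs_ballP; exists (r - mdist x y) => /=; first by rewrite subr_gt0.
move=> z; rewrite !ballEmdist/= => yz.
by apply: le_lt_trans (metric_triangle x y z) _; rewrite -ltrBrDl.
Qed.

Lemma open_complete_measurable (U : set X) : open U -> measurable U.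
Proof.
move=> oU; rewrite mu_borel; exists U; first exact: sub_sigma_algebra.
exists set0; last by rewrite setU0.
by exists set0; split => //; exact: measure0.
Qed.

Lemma measurable_metric_ball (x : X) (r : R) : measurable (ball x r).
Proof. exact/open_complete_measurable/open_metric_ball. Qed.

(** For each k only finitely many disjoint subsets of [V] can have measure at least 1/(k+1), because
    [V] has finite measure. *)
Lemma disjoint_positive_countable (D : set X) (F : X -> set X) (V : set X) :
  measurable V -> (mu V < +oo)%E -> trivIset D F ->
  (forall y, D y -> [/\ measurable (F y), F y `<=` V & (0 < mu (F y))%E]) ->
  countable D.
Proof.
move=> mV Voo tD hF.
pose E (k : nat) := [set y | D y /\ (k.+1%:R^-1%:E <= mu (F y))%E].
have -> : D = \bigcup_k E k.
  apply/seteqP; split => [y Dy|y [k _ []//]].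
  have [_ FV Fpos] := hF y Dy.
  have Ffin : mu (F y) \is a fin_num.
    rewrite ge0_fin_numE//; apply: le_lt_trans Voo.
    have [mF _ _] := hF y Dy.
    by apply: le_measure => //; rewrite inE.
  move: Fpos; rewrite -(fineK Ffin) lte_fin => Fpos.
  exists (Num.truncn (fine (mu (F y)))^-1) => //; split => //.
  rewrite -(fineK Ffin) lee_fin -[leRHS]invrK lef_pV2 ?posrE ?invr_gt0//.
  exact/ltW/truncnS_gt.
apply: bigcup_countable => // k _; apply: finite_set_countable.
apply: contrapT => infE.
have Vfin : mu V \is a fin_num by rewrite ge0_fin_numE.
(* So many disjoint sets of measure at least 1/(k+1) have total measure greater than that of [V]. *)
pose n := (Num.truncn (k.+1%:R * fine (mu V))).+1.
have [B BE nB] := infinite_set_fset n infE.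
have tB : trivIset [set` B] F by apply: sub_trivIset tD => y /BE[].
have mB y : y \in B -> measurable (F y) by move=> /BE[/hF[]].
have := measure_fbigsetU mu mB tB; rewrite -bigcup_fset => muB.
have : (mu (\bigcup_(y in [set` B]) F y) <= mu V)%E.
  apply: le_measure; rewrite ?inE//.
    by apply: fin_bigcup_measurable => // y /mB.
  by move=> x [y /BE[/hF[_ FV _] _]] /FV.
rewrite muB; apply/negP; rewrite -ltNge -(fineK Vfin).
apply: (@lt_le_trans _ _ (\sum_(y <- B) k.+1%:R^-1%:E)%E).
  rewrite sumEFin lte_fin big_const_seq count_predT iter_addr_0 -[ltRHS]mulr_natr.
  rewrite -ltr_pdivrMl ?invr_gt0// invrK.
  by apply: lt_le_trans (truncnS_gt _) _; rewrite ler_nat.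
by rewrite big_seq [leRHS]big_seq; apply: lee_sum => y /BE[].
Qed.

Lemma maximal_separated (S : set X) (e : R) : 0 < e ->
  exists M : set X, [/\ M `<=` S,
    forall x y, M x -> M y -> x <> y -> e <= mdist x y &
    forall x, S x -> exists2 y, M y & mdist x y < e].
Proof.
move=> e0.
pose P := [set M : set X | M `<=` S /\
  forall x y, M x -> M y -> x <> y -> e <= mdist x y].
have [F FP totF|M [[MS Msep] Mmax]] := @Zorn_bigcup _ P.
  split => [x [A /FP[AS _] /AS]//|x y [A FA Ax] [B FB By]].
  have [AB|BA] := totF A B FA FB.
    by have [_] := FP B FB; apply => //; exact: AB.
  by have [_] := FP A FA; apply => //; exact: BA.
exists M; split => // x Sx; apply: contrapT => nx.
have far y : M y -> e <= mdist x y.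
  by move=> My; rewrite leNgt; apply/negP => xy; apply: nx; exists y.
apply: (Mmax (x |` M)).
  split; first by move=> y My; right.
  by move=> /(_ x (or_introl erefl)) /far; rewrite mdistxx leNgt e0.
split => [y [->//|/MS//]|y z [->|My] [->|Mz]] //.
- by move=> _; exact: far.
- by move=> _; rewrite metric_sym; exact: far.
- exact: Msep.
Qed.

Hypothesis mu_ball : forall (x : X) (r : R), 0 < r ->
  (0 < mu (ball x r))%E /\ (mu (ball x r) < +oo)%E.

Lemma separated_countable (M : set X) (e : R) : 0 < e ->
  (forall x y, M x -> M y -> x <> y -> e <= mdist x y) -> countable M.
Proof.
move=> e0 Msep; have [->|/set0P[x0 _]] := eqVneq M set0; first exact: countable0.
have -> : M = \bigcup_(n : nat) (M `&` ball x0 n.+1%:R).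
  apply/seteqP; split => [x Mx|x [n _ []//]].
  exists (Num.truncn (mdist x0 x)) => //; split => //.
  by rewrite ballEmdist/=; exact: truncnS_gt.
apply: bigcup_countable => // n _.
have e20 : 0 < e / 2 by rewrite divr_gt0.
have ne : 0 < n.+1%:R + e :> R by rewrite ltr_wpDl.
apply: (@disjoint_positive_countable _ (fun y => ball y (e / 2)) (ball x0 (n.+1%:R + e))).
- exact: measurable_metric_ball.
- exact: (mu_ball x0 ne).2.
- move=> y z [My _] [Mz _] [w []]; rewrite !ballEmdist/= => yw zw.
  apply: contrapT => yz; have := Msep y z My Mz yz; apply/negP; rewrite -ltNge.
  apply: le_lt_trans (metric_triangle y w z) _; rewrite (metric_sym w z).
  by rewrite (splitr e) ltrD.
- move=> y [My xy]; split.
  + exact: measurable_metric_ball.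
  + move=> z; move: xy; rewrite !ballEmdist/= => xy yz.
    apply: le_lt_trans (metric_triangle x0 y z) _; apply: ltrD => //.
    by apply: lt_trans yz _; rewrite ltr_pdivrMr// ltr_pMr// ltr1n.
  + exact: (mu_ball y e20).1.
Qed.

(* Balls of positive finite measure make [X] separable, so a property of small
   balls that passes to smaller balls holds on a countable open cover. *)
Lemma countable_ball_cover (Q : set X -> Prop) :
  Q set0 -> (forall A B, A `<=` B -> measurable A -> measurable B -> Q B -> Q A) ->
  (forall x, exists2 r : R, 0 < r & Q (ball x r)) ->
  exists C : nat -> set X, [/\ forall n, open (C n), forall n, Q (C n) &
    forall x, exists n, C n x].
Proof.
move=> Q0 Qs hQ; pose e (k : nat) : R := k.+1%:R^-1.
have e0 k : 0 < e k by rewrite invr_gt0.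
(* A maximal [e k]-separated subset of [S k] comes within [e k] of each of its points, so the balls
   of twice that radius cover [S k] and still satisfy [Q]. *)
pose S k := [set x | Q (ball x (e k + e k))].
have [M hM] := choice (fun k => maximal_separated (S k) (e0 k)).
pose D := [set yk : X * nat | M yk.2 yk.1].
have cD : countable D.
  have -> : D = \bigcup_k ((fun y => (y, k)) @` M k).
    apply/seteqP; split => [[y k] Myk|[y k] [j _ [z Mz [<- <-]]]//].
    by exists k => //; exists y.
  apply: bigcup_countable => // k _; apply: (sub_countable (card_image_le _ _)).
  by have [_ sep _] := hM k; exact: separated_countable sep.
have /countable_injP[f finj] := cD.
(* [f] numbers the centres; indices that it does not attain give the empty set, whence the
   assumption [Q set0]. *)
pose C n := [set x | exists2 yk, D yk /\ f yk = n & ball yk.1 (e yk.2 + e yk.2) x].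
have CE n : C n = set0 \/ exists2 yk, D yk & C n = ball yk.1 (e yk.2 + e yk.2).
  have [[yk [Dyk fyk]]|nyk] := pselect (exists yk, D yk /\ f yk = n); last first.
    by left; rewrite -subset0 => x [yk h _]; apply: nyk; exists yk.
  right; exists yk => //; apply/seteqP; split => [x [zk [Dzk fzk]]|x xyk].
    by suff -> : zk = yk by []; apply: (finj zk yk); rewrite ?fzk ?fyk// inE.
  by exists yk.
exists C; split.
- move=> n; have [->|[yk _ ->]] := CE n; [exact: open0|exact: open_metric_ball].
- move=> n; have [->//|[yk Dyk ->]] := CE n.
  by have [MS _ _] := hM yk.2; exact: MS.
- move=> x; have [r r0 xr] := hQ x.
  pose k := Num.truncn (2 / r).
  have ekr : e k + e k <= r.
    rewrite -mulr2n -mulr_natl /e ler_pdivrMr// mulrC -ler_pdivrMr//.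
    exact/ltW/truncnS_gt.
  have Sx : S k x.
    apply: Qs xr; [|exact: measurable_metric_ball..].
    by move=> z; rewrite !ballEmdist/= => /lt_le_trans; apply.
  have [_ _ /(_ x Sx)[y My xy]] := hM k.
  exists (f (y, k)), (y, k) => //=; rewrite ballEmdist/= metric_sym.
  by apply: lt_le_trans xy _; rewrite lerDl ltW.
Qed.

End countable_cover.

Section minimal_gradient.
Context {R : realType} {d : measure_display} {X : metricMeasurableType R d}.
Variables (mu : {measure set X -> \bar R}) (p : R).
Hypotheses (p0 : 0 < p) (mu_borel : complete_borel mu).
Hypothesis mu_ball : forall (x : X) (r : R), 0 < r ->
  (0 < mu (ball x r))%E /\ (mu (ball x r) < +oo)%E.
Local Open Scope ereal_scope.
Local Notation leb := (@lebesgue_measure R).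

(** [h] has finite energy on each member of a countable open cover, and a curve, being compact,
    meets only finitely many members before it is covered. *)
Lemma locally_Lp_density (h : X -> \bar R) : curve_measurable h -> locally_Lp mu p h ->
  exists2 rho, density mu p rho & forall c : curve X, line_integral c rho < +oo ->
    line_integral c h < +oo.
Proof.
move=> ch [_ Lh]; have [[h0 mh] mch] := ch.
pose Q A := \int[mu]_(x in A) (`|h x| `^ p) < +oo.
have [|A B AB _ _|x|C [oC QC cC]] := @countable_ball_cover _ _ _ mu mu_borel mu_ball Q.
- by rewrite /Q integral_set0 ltry.
- apply: le_lt_trans; apply: ge0_subset_lower_integral => // x _.
  exact: poweR_ge0.
- exact: Lh.
pose i n x : \bar R := if `[< C n x >] then 1 else 0.
have i0 n x : 0 <= i n x by rewrite /i; case: ifP.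
(* The superlevel sets of the indicator are everything, [C n] or empty; openness of [C n] therefore
   makes it measurable along curves. *)
have bi n (r : R) : <<s @open X >> [set x | r%:E < i n x].
  pose Y := g_sigma_algebraType (@open X).
  suff : @measurable _ Y [set x | r%:E < i n x] by [].
  have [r0|r0] := ltP r 0%R.
    rewrite (_ : [set x | _] = setT); first exact: measurableT.
    by apply/seteqP; split => // x _ /=; apply: lt_le_trans (i0 n x); rewrite lte_fin.
  have [r1|r1] := ltP r 1%R.
    rewrite (_ : [set x | _] = C n); first exact: sub_sigma_algebra.
    apply/seteqP; split => x /=; rewrite /i.
      by case: ifPn => [/asboolP//|_]; rewrite lte_fin ltNge r0.
    by move=> Cx; rewrite asboolT// lte_fin.
  rewrite (_ : [set x | _] = set0); first exact: measurable0.
  by rewrite -subset0 => x /=; rewrite /i; case: ifP => _; rewrite lte_fin ltNge ?r1 ?r0.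
have mC n : measurable (C n) by exact: (open_complete_measurable mu_borel).
have mi n : measurable_fun setT (i n).
  apply: measurable_fun_ifT => //; apply: (measurable_fun_bool true).
  rewrite setTI (_ : _ @^-1` _ = C n)//.
  by apply/seteqP; split => x /=; [move/asboolP|move=> ?; apply/asboolP].
pose rho_ n x := h x * i n x.
have drho n : density mu p (rho_ n).
  split.
    split; first (split; first by move=> x; exact: mule_ge0).
      exact: emeasurable_funM.
    move=> c; have mic := borel_curve_measurable (bi n).
    by apply: emeasurable_funM; [exact: mch|exact: mic].
  rewrite int_powE; last by move=> x; exact: mule_ge0.
  apply: le_lt_trans (QC n); rewrite [leRHS]integral_mkcond.
  apply: ge0_le_lower_integral => x _; first exact: poweR_ge0.
  rewrite patchE /rho_ /i; case: ifPn => [/asboolP Cx|/asboolP nCx].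
    by rewrite mem_set// mule1 gee0_abs.
  by rewrite memNset// mule0 poweR0r// gt_eqF.
have [rho drho' [k k0 hk]] := density_seq p0 drho; exists rho => // c coo.
have rho0 := drho'.1.1.1.
have : compact (c @` `[0%R, curve_len c]).
  by apply: continuous_compact; [exact: curve_continuous|exact: segment_compact].
rewrite compact_cover => /(_ nat setT C (fun n _ => oC n))[].
  by move=> x _; have [n Cx] := cC x; exists n.
(* On [C n] the function [h] is at most [(k n)^-1 * rho]; summing the factors over the finite
   subcover bounds [h] by [K * rho] along the whole curve. *)
move=> D _ cov; pose K : R := (\sum_(n <- D) (k n)^-1)%R.
have K0 : (0 <= K)%R by apply: sumr_ge0 => n _; rewrite invr_ge0 ltW.
apply: (@le_lt_trans _ _ (line_integral c (fun x => K%:E * rho x))); last first.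
  rewrite line_integralZ//; last exact: drho'.1.
  by rewrite lte_mul_pinfty.
apply: ge0_le_lower_integral => t tc; first exact: h0.
have [|n nD Cn] := cov (c t); first by exists t.
have hkn : h (c t) <= (k n)^-1%:E * rho (c t).
  rewrite lee_pdivlMl//; apply: le_trans (hk n (c t)).
  by rewrite /rho_ /i asboolT// mule1.
apply: le_trans hkn _; apply: lee_wpmul2r; first exact: rho0.
rewrite lee_fin /K (big_fsetD1 n)//= lerDl; apply: sumr_ge0 => j _.
by rewrite invr_ge0 ltW.
Qed.

Lemma ae_eq_of_int_pow (f g : X -> \bar R) : nonneg_measurable f -> nonneg_measurable g ->
  (forall x, f x <= g x) -> int_pow mu p g < +oo -> int_pow mu p g <= int_pow mu p f ->
  {ae mu, forall x, f x = g x}.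
Proof.
move=> [f0 mf] [g0 mg] fg goo gf.
have mfp := measurable_int_pow p mf; have mgp := measurable_int_pow p mg.
have foo : int_pow mu p f < +oo by apply: le_lt_trans goo; exact: int_pow_le.
have intf : mu.-integrable setT (fun x => f x `^ p).
  apply/integrableP; split => //; move: foo; rewrite int_powE//.
  by under eq_integral do rewrite -[X in X `^ p]gee0_abs//;
     under [X in _ -> X < _]eq_integral do rewrite gee0_abs ?poweR_ge0// -[X in X `^
       p]gee0_abs//.
have intg : mu.-integrable setT (fun x => g x `^ p).
  apply/integrableP; split => //; move: goo; rewrite int_powE//.
  by under [X in _ -> X < _]eq_integral do rewrite gee0_abs ?poweR_ge0//.
have := integralB measurableT intg intf.
rewrite -!int_powE// => E.
have fin : int_pow mu p f \is a fin_num by rewrite ge0_fin_numE// int_pow_ge0.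
have E0 : int_pow mu p g - int_pow mu p f = 0.
  rewrite (_ : int_pow mu p g = int_pow mu p f) ?subee//.
  by apply/eqP; rewrite eq_le gf int_pow_le.
rewrite E0 in E.
have gef x : 0 <= g x `^ p - f x `^ p \/ g x `^ p = +oo.
  have := poweR_le p0 (f0 x) (fg x); case: (g x `^ p) => [r| |]; try by right.
    by case: (f x `^ p) => [s| |]//; left; rewrite ?subre_ge0// -EFinB lee_fin subr_ge0.
  by have := poweR_ge0 (f x) p; case: (f x `^ p).
have ging := integrable_ae measurableT intg.
have mB : measurable_fun setT (fun x => g x `^ p - f x `^ p) by exact: emeasurable_funB.
have : \int[mu]_x `|g x `^ p - f x `^ p| = 0.
  rewrite -E; apply: ae_eq_integral => //; first exact: measurableT_comp.
  apply: filterS ging => x /(_ I) gfin _.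
  by have [ge0|goo'] := gef x; [rewrite gee0_abs|rewrite goo' in gfin].
move/(ae_eq_integral_abs mu measurableT mB) => gf0.
apply: filterS2 ging gf0 => x /(_ I) gfin /(_ I)/= gfx0.
have ffin : f x `^ p \is a fin_num.
  rewrite ge0_fin_numE ?poweR_ge0//; apply: le_lt_trans (poweR_le p0 (f0 x) (fg x)) _.
  by rewrite -ge0_fin_numE ?poweR_ge0.
have gfx : g x `^ p = f x `^ p.
  move: gfx0; rewrite -(fineK gfin) -(fineK ffin) -EFinB => -[/eqP].
  by rewrite subr_eq0 => /eqP ->.
by rewrite -[LHS]poweRe1// -[RHS]poweRe1// -(@mulfV _ p) ?gt_eqF// !poweRrM gfx.
Qed.

(** Least energy implies pointwise minimality: the minimum of the energy minimizer and another
    gradient is again a gradient, cannot have less energy, and so equals the minimizer a.e. *)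
Lemma minimal_wug_exists (f : X -> \bar R) :
  (exists2 g, weak_upper_gradient mu p f g & int_pow mu p g < +oo) ->
  exists g, minimal_weak_upper_gradient mu p f g.
Proof.
move=> [g1 fg1 g1oo].
pose I := ereal_inf [set int_pow mu p g | g in weak_upper_gradient mu p f].
have I0 : 0 <= I by apply: le_ereal_inf_tmp => _ [g _ <-]; exact: int_pow_ge0.
have Ifin : I \is a fin_num.
  by rewrite ge0_fin_numE//; apply: le_lt_trans g1oo; apply: ereal_inf_lbound; exists g1.
have H n : exists g, [/\ density mu p g, weak_upper_gradient mu p f g &
    int_pow mu p g <= I + n.+1%:R^-1%:E].
  have [_ [g fg <-] hg] : exists2 y, [set int_pow mu p g | g in weak_upper_gradient mu p f] y &
      y < I + n.+1%:R^-1%:E by apply: lb_ereal_inf_adherent.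
  have [|g' [dg' fg' E _]] := wug_density_majorant p0 mu_borel fg.
    by apply: lt_trans hg _; rewrite -(fineK Ifin) -EFinD ltry.
  by exists g'; split => //; rewrite E ltW.
have {H}[g_ hg] := choice H.
(* Running minima turn a minimizing sequence into a decreasing one without increasing the
   energies. *)
pose G := fix G n := if n is n'.+1 then (fun x => mine (G n' x) (g_ n'.+1 x)) else g_ 0%N.
have GS n : G n.+1 = (fun x => mine (G n x) (g_ n.+1 x)) by [].
have Gle n x : G n x <= g_ n x by case: n => // n; rewrite GS ge_min lexx orbT.
have hG n : density mu p (G n) /\ weak_upper_gradient mu p f (G n).
  elim: n => [|n [dG fG]]; first by have [] := hg 0%N.
  have [dgn fgn _] := hg n.+1; rewrite GS; split; last first.
    by apply: controls_min => //; exact: density_wug_controls.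
  split; first by apply: curve_measurable_min; [exact: dG.1|exact: dgn.1].
  apply: le_lt_trans dgn.2; apply: int_pow_le => // x; last by rewrite ge_min lexx orbT.
  by rewrite le_min dG.1.1.1 dgn.1.1.1.
have G0 n x : 0 <= G n x by exact: (hG n).1.1.1.1.
have Gni x : nonincreasing_seq (G ^~ x).
  by apply/nonincreasing_seqP => n; rewrite GS ge_min lexx.
pose Ginf x := ereal_inf (range (G ^~ x)).
have Ginf0 x : 0 <= Ginf x by apply: le_ereal_inf_tmp => _ [n _ <-].
have GinfG n x : Ginf x <= G n x by apply: ereal_inf_lbound; exists n.
have cG : curve_measurable Ginf.
  have E T (h : nat -> T -> \bar R) :
      (fun x => ereal_inf (range (fun n => h n x))) = (fun x => einfs (h ^~ x) 0%N).
    apply/funext => x; rewrite /einfs/sdrop; congr ereal_inf.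
    by apply/seteqP; split => _ [n _ <-]; exists n.
  split; first split => //.
    by rewrite /Ginf E; apply: measurable_fun_einfs => n; exact: (hG n).1.1.1.2.
  move=> c; rewrite /comp /Ginf (E _ (fun n => G n \o c)).
  by apply: measurable_fun_einfs => n; exact: (hG n).1.1.2.
have GI : int_pow mu p Ginf <= I.
  apply/lee_addgt0Pr => e e0.
  pose n := Num.truncn e^-1.
  have [_ _ hn] := hg n; apply: le_trans (le_trans hn _).
    by apply: int_pow_le => // x; exact: le_trans (GinfG n x) (Gle n x).
  apply: leeD2l; rewrite lee_fin -[leRHS]invrK lef_pV2 ?posrE ?invr_gt0//.
  exact/ltW/truncnS_gt.
have Goo : int_pow mu p Ginf < +oo by apply: le_lt_trans GI _; rewrite -ge0_fin_numE.
have fG : weak_upper_gradient mu p f Ginf.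
  have H n : exists rho, density mu p rho /\ forall c : curve X, line_integral c rho < +oo ->
      `|f (c 0%R) - f (c (curve_len c))| <= line_integral c (G n).
    by have [rho ? ?] := wug_density p0 mu_borel (hG n).2; exists rho.
  have {H}[rho_ hrho] := choice H.
  have [rho1 d1 h1] := density_seq_line_integral p0 (fun n => (hrho n).1).
  (* Adding [G 0] to the density makes it integrable along the curve, where it dominates the
     decreasing sequence. *)
  have [rho drho h2] := density_pair p0 d1 (hG 0%N).1.
  apply: (density_wug cG.1 drho) => c /h2[/h1 c1 c2].
  have Gcvg : \int[leb]_(t in `[0%R, curve_len c]) G n (c t) @[n --> \oo] -->
      \int[leb]_(t in `[0%R, curve_len c]) Ginf (c t).
    have [] := @dominated_convergence _ _ _ leb _ (measurable_itv `[0%R, curve_len c])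
      (fun n => G n \o c) (Ginf \o c) (G 0%N \o c) => //.
    - by move=> n; exact: (hG n).1.1.2.
    - exact: cG.2.
    - by apply/aeW => t _ /=; exact: (ereal_nonincreasing_cvgn (Gni (c t))).
    - apply/integrableP; split; first exact: (hG 0%N).1.1.2.
      apply: le_lt_trans c2; apply: ge0_le_lower_integral => t _ //.
      by rewrite [(_ \o _) t]/(G 0%N (c t)) (gee0_abs (G0 0%N (c t))).
    - by apply/aeW => t n _ /=; rewrite gee0_abs//; exact: (Gni (c t) 0%N n).
  rewrite /line_integral -(cvg_lim _ Gcvg)//; apply: lime_ge.
    by apply/cvg_ex; eexists; exact: Gcvg.
  by apply: nearW => n; exact: (hrho n).2.
exists Ginf; split => //.
  split; first exact: cG.1.2.
  move=> x; exists 1%R => //; apply: le_lt_trans Goo.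
  by apply: ge0_subset_lower_integral => // y _; exact: poweR_ge0.
move=> h fh [mh Lh].
(* The competitor [h] is only locally in L^p, so it is not itself a density; its majorant still has
   finite integral along almost every curve. *)
have [h' [ch' hh' aeh]] := borel_majorant mu_borel fh.1.
have fh' := wug_le fh hh' ch'.1.
have Lh' : locally_Lp mu p h'.
  split; first exact: ch'.1.2.
  move=> x; have [r r0 hr] := Lh x; exists r => //; apply: le_lt_trans hr.
  rewrite le_eqVlt; apply/orP; left; apply/eqP; apply: ge0_ae_eq_integral.
  - exact: (measurable_metric_ball mu_borel).
  - apply: measurable_funTS; apply: measurable_int_pow.
    by apply: measurableT_comp => //; exact: ch'.1.2.
  - by apply: measurable_funTS; apply: measurable_int_pow; exact: measurableT_comp.
  - by move=> y _; exact: poweR_ge0.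
  - by move=> y _; exact: poweR_ge0.
  - by apply: filterS aeh => y ->.
have [rho drho hrho] := locally_Lp_density ch' Lh'.
have Ch' := wug_controls p0 mu_borel fh' ch' drho hrho.
have CG := density_wug_controls p0 mu_borel fG (conj cG Goo).
have fm := controls_min p0 CG Ch'.
have : {ae mu, forall x, mine (Ginf x) (h' x) = Ginf x}.
  apply: ae_eq_of_int_pow => //; first exact: fm.1.
  - exact: cG.1.
  - by move=> x; rewrite ge_min lexx.
  - by apply: le_trans GI _; apply: ereal_inf_lbound; exists (fun x => mine (Ginf x) (h' x)).
apply: filterS2 aeh => x <- <-.
by rewrite ge_min lexx orbT.
Qed.

Lemma min_wugP (f g : X -> \bar R) :
  weak_upper_gradient mu p f g -> int_pow mu p g < +oo ->
  weak_upper_gradient mu p f (min_wug mu p f) /\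
  dirichlet_energy mu p f <= int_pow mu p g.
Proof.
move=> fg goo; have := @minimal_wug_exists f (ex_intro2 _ _ g fg goo).
move=> /(xgetPex (cst +oo)); rewrite -/(min_wug mu p f) => -[fm Lm hm].
split => //; apply: ae_int_pow_le => //; [exact: fm.1|exact: fg.1|].
apply: hm => //; split; first exact: fg.1.2.
move=> x; exists 1%R => //; apply: le_lt_trans goo.
by apply: ge0_subset_lower_integral => // y _; exact: poweR_ge0.
Qed.

End minimal_gradient.

(** * Sets of capacity zero *)

Section thin_sets.
Context {R : realType} {d : measure_display} {X : metricMeasurableType R d}.
Variables (mu : {measure set X -> \bar R}) (p : R).
Hypotheses (p0 : 0 < p) (mu_borel : complete_borel mu).
Hypothesis mu_ball : forall (x : X) (r : R), 0 < r ->
  (0 < mu (ball x r))%E /\ (mu (ball x r) < +oo)%E.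
Local Open Scope ereal_scope.
Local Notation leb := (@lebesgue_measure R).

(** The form in which exceptional sets of q.e. statements are used: changing a function on such a
    set affects neither its measurability nor its weak upper gradients. *)
Definition thin (Z : set X) : Prop :=
  mu.-negligible Z /\ exists2 rho, density mu p rho &
    forall c : curve X, line_integral c rho < +oo ->
      forall t, `[0%R, curve_len c]%classic t -> ~ Z (c t).

Lemma thinU (Z1 Z2 : set X) : thin Z1 -> thin Z2 -> thin (Z1 `|` Z2).
Proof.
move=> [n1 [rho1 d1 h1]] [n2 [rho2 d2 h2]]; split; first exact: negligibleU.
have [rho drho h] := density_pair p0 d1 d2; exists rho => // c /h[c1 c2] t tc.
by move=> [|]; [exact: h1 tc|exact: h2 tc].
Qed.

Lemma thin_wug (Z : set X) (f f' g : X -> \bar R) : thin Z ->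
  (forall x, ~ Z x -> f' x = f x) -> weak_upper_gradient mu p f g ->
  weak_upper_gradient mu p f' g.
Proof.
move=> [_ [rho1 d1 h1]] ff' fg; have [rho2 d2 h2] := wug_density p0 mu_borel fg.
have [rho drho h] := density_pair p0 d1 d2.
apply: (density_wug fg.1 drho) => c /h[c1 c2]; have l0 := ltW (curve_len_gt0 c).
rewrite !ff'; first exact: h2.
  by apply: (h1 c c1); rewrite /= in_itv/= lexx andbT.
by apply: (h1 c c1); rewrite /= in_itv/= lexx.
Qed.

Lemma newtonian_wug (f : X -> \bar R) : newtonian mu p f ->
  exists2 g, weak_upper_gradient mu p f g & int_pow mu p g < +oo.
Proof.
move=> [_ foo].
have : ereal_inf [set int_pow mu p g | g in weak_upper_gradient mu p f] < +oo.
  by apply: le_lt_trans foo; apply: leeDr; exact: int_pow_ge0.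
by move=> /ereal_inf_lt[_ [g fg <-] goo]; exists g.
Qed.

(* The functions [n.+1 * g_ n] and [n.+1 * h_ n] have a supremum in L^p.  Along
   a curve where both suprema have a finite integral, [u_ n] varies by less than
   1/2 while its mean tends to 0, so [u_ n] is smaller than 1 on the curve. *)
Lemma capacity0_thin (Z : set X) : sobolev_capacity mu p Z = 0 -> thin Z.
Proof.
(* The division by (n+1)^p compensates the later factor n+1, leaving energies at most 2^-(n+1). *)
move=> capZ; pose e (n : nat) : R := ((1 / (2 ^ n.+1)%:R) / n.+1%:R `^ p)%R.
have e0 n : (0 < e n)%R by rewrite !divr_gt0// ?powR_gt0// ltr0n expn_gt0.
have H n : exists ugh : (X -> \bar R) * (X -> \bar R) * (X -> \bar R),
    [/\ forall x, Z x -> 1 <= ugh.1.1 x,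
      controls mu p ugh.1.1 ugh.1.2, int_pow mu p ugh.1.2 <= (e n)%:E &
      [/\ curve_measurable ugh.2, forall x, `|ugh.1.1 x| <= ugh.2 x &
      int_pow mu p ugh.2 <= (e n)%:E]].
  have [|_ [u [[mu_ _] uZ] <-]] := @lb_ereal_inf_adherent _
    [set newtonian_normp mu p u | u in newtonian mu p `&` [set u | forall x, Z x -> 1 <= u x]]
    (e n) (e0 n); rewrite -/(sobolev_capacity mu p Z) capZ//.
  rewrite add0e => une.
  have une1 : int_pow mu p u < (e n)%:E.
    apply: le_lt_trans une; apply: leeDl; apply: le_ereal_inf_tmp => _ [g _ <-].
    exact: int_pow_ge0.
  have : ereal_inf [set int_pow mu p g | g in weak_upper_gradient mu p u] < (e n)%:E.
    by apply: le_lt_trans une; apply: leeDr; exact: int_pow_ge0.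
  move=> /ereal_inf_lt[_ [g ug <-] gne].
  have [g' [dg' ug' E _]] := wug_density_majorant p0 mu_borel ug (lt_trans gne (ltry _)).
  have nabs : nonneg_measurable (fun x => `|u x|).
    by split => [x|]; [exact: abse_ge0|exact: measurableT_comp].
  have [h [ch uh aeh]] := borel_majorant mu_borel nabs.
  exists (u, g', h); split => //=; first exact: density_wug_controls.
    by rewrite E ltW.
  split => //; apply: le_trans (ltW une1).
  have <- : int_pow mu p (fun x => `|u x|) = int_pow mu p u.
    by apply: eq_integral => x _; rewrite abse_id.
  apply: ae_int_pow_le => //; first exact: ch.1.
  by apply: filterS aeh => x ->.
have {H}[ugh hugh] := choice H.
pose u_ n := (ugh n).1.1; pose g_ n := (ugh n).1.2; pose h_ n := (ugh n).2.
have sup_density (f : nat -> X -> \bar R) : (forall n, curve_measurable (f n)) ->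
    (forall n, int_pow mu p (f n) <= (e n)%:E) ->
    density mu p (fun x => ereal_sup (range (fun n => n.+1%:R%:E * f n x))).
  move=> cf fe.
  have cnf n : curve_measurable (fun x => n.+1%:R%:E * f n x).
    have [[f0 mf] mcf] := cf n.
    split; first (split; first by move=> x; rewrite mule_ge0// lee_fin).
      exact: emeasurable_funM.
    by move=> c; apply: emeasurable_funM => //; exact: mcf.
  split; first exact: (@curve_measurable_esups _ _ _ (fun n x => n.+1%:R%:E * f n x)).
  apply: le_lt_trans (@int_pow_esups _ _ _ mu p p0 (fun n x => n.+1%:R%:E * f n x) _) _.
    by move=> n; exact: (cnf n).1.
  apply: (@le_lt_trans _ _ 1%:E); last exact: ltry.
  apply: le_trans (@epsilon_trick0 R 1 xpredT ler01).
  apply: lee_nneseries => n *; first exact: int_pow_ge0.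
  rewrite int_powZ//; last exact: (cf n).1.
  apply: (@le_trans _ _ ((n.+1%:R `^ p)%:E * (e n)%:E)).
    by apply: lee_wpmul2l (fe n); rewrite lee_fin powR_ge0.
  by rewrite -EFinM lee_fin /e mulrC divfK// gt_eqF// powR_gt0.
pose G x := ereal_sup (range (fun n => n.+1%:R%:E * g_ n x)).
pose H x := ereal_sup (range (fun n => n.+1%:R%:E * h_ n x)).
have dG : density mu p G.
  apply: sup_density => n; have [_ c1 c2 _] := hugh n; [exact: c1.1|exact: c2].
have dH : density mu p H.
  by apply: sup_density => n; have [_ _ _ []] := hugh n.
(* On [Z] each [h_ n] is at least 1, hence [H] is at least n+1 for all n; since [H] has finite
   energy, [Z] is negligible. *)
have HZ x : Z x -> H x = +oo.
  move=> Zx; apply/eqyP => r r0; apply: (@le_trans _ _ (Num.truncn r).+1%:R%:E).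
    by rewrite lee_fin; exact/ltW/truncnS_gt.
  apply: (@le_trans _ _ ((Num.truncn r).+1%:R%:E * h_ (Num.truncn r) x)).
    have [uZ _ _ [_ uh _]] := hugh (Num.truncn r).
    rewrite -[leLHS]mule1; apply: lee_wpmul2l => //.
    by apply: le_trans (uh x); apply: le_trans (lee_abs _); exact: uZ.
  by apply: ereal_sup_ubound; exists (Num.truncn r).
split.
  have intH : mu.-integrable setT (fun x => H x `^ p).
    apply/integrableP; split; first by apply: measurable_int_pow; exact: dH.1.1.2.
    apply: le_lt_trans dH.2; rewrite int_powE; last exact: dH.1.1.1.
    by apply: ge0_le_lower_integral => // x _; rewrite gee0_abs// poweR_ge0.
  have := integrable_ae measurableT intH; apply: negligibleS => x Zx /= /(_ I).
  by rewrite HZ// poweRyr// gt_eqF.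
have rhoP n : exists rho, density mu p rho /\ forall c : curve X, line_integral c rho < +oo ->
    [/\ line_integral c (g_ n) < +oo,
      forall t, `[0%R, curve_len c]%classic t -> u_ n (c t) \is a fin_num &
      forall s t, (0 <= s)%R -> (s <= t)%R -> (t <= curve_len c)%R ->
        `|fine (u_ n (c s)) - fine (u_ n (c t))|%:E <= \int[leb]_(r in `[s, t]) g_ n (c r)].
  by have [_ [_ [rho ? ?]] _ _] := hugh n; exists rho.
have {rhoP}[rho_ hrho] := choice rhoP.
have [rho1 d1 h1] := density_seq_line_integral p0 (fun n => (hrho n).1).
have [rho2 d2 h2] := density_pair p0 dG dH.
have [rho drho hr] := density_pair p0 d1 d2.
exists rho => // c /hr[/h1 c1 /h2[cG cH]] t0 t0c Zt.
have l0 := curve_len_gt0 c.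
have smallint (f : nat -> X -> \bar R) : (forall n, curve_measurable (f n)) ->
    line_integral c (fun x => ereal_sup (range (fun n => n.+1%:R%:E * f n x))) < +oo ->
    exists2 J : R, (0 <= J)%R & forall n, line_integral c (f n) <= (J / n.+1%:R)%:E.
  move=> cf; set I := line_integral c _ => Ioo.
  have I0 : 0 <= I.
    apply: line_integral_ge0 => x; apply: (@le_trans _ _ (1%:R%:E * f 0%N x)).
      by rewrite mule_ge0// (cf 0%N).1.1.
    by apply: ereal_sup_ubound; exists 0%N.
  have Ifin : I \is a fin_num by rewrite ge0_fin_numE.
  exists (fine I); first by rewrite fine_ge0.
  move=> n; rewrite mulrC EFinM fineK// lee_pdivlMl//.
  rewrite -line_integralZ//; apply: line_integral_le => x.
    by rewrite mule_ge0// (cf n).1.1.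
  by apply: ereal_sup_ubound; exists n.
have [J J0 hJ] := smallint g_ (fun n => let: And4 _ c1 _ _ := hugh n in c1.1) cG.
have [K K0 hK] := smallint h_ (fun n => let: And4 _ _ _ (And3 c2 _ _) := hugh n in c2) cH.
(* With this [n] the oscillation along the curve is below 1/2 and the integral of [h_ n] below half
   the length. A point in [Z] would force [h_ n] to be at least 1/2 throughout, a contradiction. *)
pose n := Num.truncn (2 * J + 2 * K / curve_len c)%R.
have nn : (2 * J + 2 * K / curve_len c < n.+1%:R)%R by exact: truncnS_gt.
have KL0 : (0 <= 2 * K / curve_len c)%R by rewrite divr_ge0 ?mulr_ge0// ltW.
have Jn : (J / n.+1%:R < 1 / 2)%R by rewrite ltr_pdivrMr//; lra.
have Kn : (K / n.+1%:R < curve_len c / 2)%R.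
  rewrite ltr_pdivrMr// mulrAC ltr_pdivlMr// -ltr_pdivrMl// mulrC [(K * 2)%R]mulrC; lra.
have [uZ _ _ [ch uh _]] := hugh n; have [_ fin Hc] := (hrho n).2 c (c1 n).
have cgn : curve_measurable (g_ n) by have [_ c1' _ _] := hugh n; exact: c1'.1.
have half t : `[0%R, curve_len c]%classic t -> (1 / 2)%:E <= h_ n (c t).
  move=> tc; apply: le_trans (uh (c t)).
  have : `|fine (u_ n (c t0)) - fine (u_ n (c t))|%:E <= (J / n.+1%:R)%:E.
    apply: le_trans (hJ n); move: t0c tc; rewrite /= !in_itv/= => /andP[t00 t0l] /andP[t_0 tl].
    have [tt|tt] := leP t0 t; [|rewrite distrC]; apply: le_trans (Hc _ _ _ _ _) _ => //;
      try exact: ltW; apply: ge0_subset_lower_integral => [|x _]; try exact: subitvcc;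
      exact: cgn.1.1.
  rewrite lee_fin => /le_lt_trans/(_ Jn) hd.
  have ut0 : (1 <= fine (u_ n (c t0)))%R.
    by rewrite -lee_fin (fineK (fin t0 t0c)); exact: uZ.
  rewrite (_ : (ugh n).1.1 (c t) = (fine (u_ n (c t)))%:E); last by rewrite fineK// fin.
  rewrite /= lee_fin.
  have h0 := ler_norm (fine (u_ n (c t0)) - fine (u_ n (c t))).
  have h := ler_norm (fine (u_ n (c t))).
  move: ut0 hd h0 h; move: (fine (u_ n (c t0))) (fine (u_ n (c t))) => a b.
  by move: `|a - b|%R `|b|%R => q s; lra.
have : (curve_len c / 2)%:E <= line_integral c (h_ n).
  apply: (@le_trans _ _ (\int[leb]_(t in `[0%R, curve_len c]) (1 / 2)%:E)); last first.
    by apply: ge0_le_lower_integral => // t _; rewrite lee_fin; lra.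
  have E : \int[leb]_(t in `[0%R, curve_len c]) (1 / 2)%:E =
      (1 / 2)%:E * leb `[0%R, curve_len c]%classic.
    by rewrite integral_cst.
  have M : leb `[0%R, curve_len c]%classic = (curve_len c)%:E.
    by rewrite lebesgue_measure_itv/= lte_fin l0 -EFinB subr0.
  by rewrite E M -EFinM lee_fin; lra.
move=> /le_trans/(_ (hK n)); rewrite lee_fin leNgt Kn//.
Qed.

Lemma newtonian_bounded (f g : X -> \bar R) (k : R) (x0 : X) (r : R) :
  measurable_fun setT f -> (forall x, `|f x| <= k%:E) ->
  (forall x, ~ ball x0 r x -> f x = 0) ->
  weak_upper_gradient mu p f g -> int_pow mu p g < +oo -> newtonian mu p f.
Proof.
move=> mf fk f0 fg goo; split => //; apply: lte_add_pinfty; last first.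
  by apply: le_lt_trans goo; apply: ereal_inf_lbound; exists g.
have [r0|r0] := ltP 0%R r; last first.
  rewrite /int_pow (eq_integral (cst 0)) ?integral0// => x _.
  rewrite f0 ?abse0 ?poweR0r ?gt_eqF//.
  by rewrite ballEmdist/=; apply/negP; rewrite -leNgt (le_trans r0)// mdist_ge0.
have mB := measurable_metric_ball mu_borel x0 r.
have k0 : 0 <= k%:E by apply: le_trans (fk x0); exact: abse_ge0.
apply: (@le_lt_trans _ _ (\int[mu]_(x in ball x0 r) (k%:E `^ p))).
  rewrite [leRHS]integral_mkcond; apply: ge0_le_lower_integral => x _.
    exact: poweR_ge0.
  rewrite patchE; case: ifPn => [_|/negP xB]; first exact: poweR_le.
  by rewrite f0 ?abse0 ?poweR0r ?gt_eqF// => xb; apply: xB; exact: mem_set.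
rewrite poweR_EFin integral_cst//.
by apply: lte_mul_pinfty; rewrite ?lee_fin ?powR_ge0//; exact: (mu_ball x0 r0).2.
Qed.

(** Passes from constraints off a thin set to constraints everywhere. Boundedness of [v] and of [A]
    supplies the L^p part of the Newtonian norm. *)
Lemma variational_capacity_le_test (E A Z : set X) (v : X -> R) (g : X -> \bar R) (k : R) :
  E `<=` A -> bounded_subset A -> thin Z ->
  measurable_fun setT (EFin \o v) -> (forall x, `|v x| <= k)%R ->
  weak_upper_gradient mu p (EFin \o v) g -> int_pow mu p g < +oo ->
  (forall x, ~ Z x -> E x -> 1 <= v x)%R -> (forall x, ~ Z x -> ~ A x -> v x = 0%R) ->
  variational_capacity mu p E A <= int_pow mu p g.
Proof.
move=> EA [x0 [r Ar]] tZ mv vk vg goo vE vA.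
(* The correction acts only where [v] violates a constraint, hence only inside [Z]. *)
pose w x := if `[< E x >] then Num.max 1%R (v x) else if `[< A x >] then v x else 0%R.
have wv x : ~ Z x -> (EFin \o w) x = (EFin \o v) x.
  move=> nZ; rewrite /= /w; case: ifPn => [/asboolP Ex|_].
    by rewrite max_r// vE.
  by case: ifPn => // /asboolP nA; rewrite vA.
have wg := thin_wug tZ wv vg.
have mw := measurable_modification mu_borel tZ.1 wv mv.
have nw : newtonian mu p (EFin \o w).
  apply: (@newtonian_bounded _ g (1 + k) x0 r) => // x.
    rewrite /= lee_fin /w; have := vk x; have := normr_ge0 (v x) => n0 nk.
    case: ifP => _; last by case: ifP => _; rewrite ?normr0; lra.
    rewrite ger0_norm; last by rewrite le_max ler01.
    by rewrite ge_max; have := ler_norm (v x); lra.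
  move=> nB; rewrite /= /w; case: ifPn => [/asboolP/EA/Ar//|_].
  by case: ifPn => // /asboolP/Ar.
have [_] := min_wugP p0 mu_borel mu_ball wg goo; apply: le_trans.
apply: ereal_inf_lbound; exists (EFin \o w) => //; split => //; split => x.
  by move=> Ex; rewrite /= lee_fin /w asboolT// le_max lexx.
move=> nA; rewrite /= /w; case: ifPn => [/asboolP/EA//|_].
by rewrite asboolF.
Qed.

End thin_sets.

(** * Level sets of capacitary potentials *)

(* The first variation at [s = 0] of [(1 - L s)^p y + (1 + (1 - L) s)^p x], which
   is minimal there. *)
Lemma energy_balance {R : realType} (p K x y L : R) : 1 < p -> 0 <= x -> 0 <= y ->
  x + y <= K -> 0 < L -> L <= 1 ->
  (forall al be, 0 <= al -> 0 <= be -> al * (1 - L) + be * L = 1 ->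
     K <= al `^ p * y + be `^ p * x) ->
  x = L * K /\ y = (1 - L) * K.
Proof.
move=> p1 x0 y0 xyK L0 L1 H; have p0 : 0 < p by exact: lt_trans p1.
have xy : x + y = K.
  apply/eqP; rewrite eq_le xyK/= addrC.
  by have := H 1 1 ler01 ler01; rewrite !powR1 !mul1r; apply; lra.
have [L1E|L1N] := eqVneq L 1.
  have := H 0 1; rewrite powR0 ?gt_eqF// powR1 L1E !mul1r !mul0r !add0r => /(_ (lexx _)
    ler01 erefl).
  by lra.
have {L1N}L1 : L < 1 by rewrite lt_neqAle L1N.
(* The factors 1 - L s and 1 + (1 - L) s satisfy the constraint for every s, and both are positive
   for |s| < 1/2, where the powers are differentiable. *)
pose phi (s : R) := y * (1 - L * s) `^ p + x * (1 + (1 - L) * s) `^ p.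
have bnd (s : R) : s \in `](-1 / 2), (1 / 2)[%R ->
    0 < 1 - L * s /\ 0 < 1 + (1 - L) * s.
  by rewrite in_itv/= => /andP[s1 s2]; split; nra.
have dpow (k s : R) : 0 < 1 + k * s ->
    is_derive s 1 (fun s => (1 + k * s) `^ p) (p * (1 + k * s) `^ (p - 1) * k).
  move=> ks; have dlin : is_derive s 1 (fun s : R => 1 + k * s) k.
    have := is_deriveD (is_derive_cst (1 : R) s (1 : R)) (is_deriveZ k (is_derive_id s
      (1 : R))).
    by rewrite add0r [k *: 1]mulr1.
  exact: (@is_derive1_comp _ (fun t => t `^ p) (fun s => 1 + k * s) s _ _
    (is_derive1_powR p ks) dlin).
have dphi (s : R) : s \in `](-1 / 2), (1 / 2)[%R ->
    is_derive s 1 phi (y * (p * (1 - L * s) `^ (p - 1) * - L) +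
      x * (p * (1 + (1 - L) * s) `^ (p - 1) * (1 - L))).
  move=> /bnd[s1 s2]; have d2 := dpow (1 - L) s s2.
  have := dpow (- L) s; rewrite mulNr => /(_ s1) d1.
  have E : phi = y *: (fun s => (1 + - L * s) `^ p) + x *: (fun s => (1 + (1 - L) * s) `^ p).
    by apply/funext => r; rewrite /phi -mulNr.
  rewrite E; exact: is_deriveD.
have z0 : (0 : R) \in `](-1 / 2), (1 / 2)[%R by rewrite in_itv/=; apply/andP; split; lra.
have : is_derive (0 : R) (1 : R) phi 0.
  apply: (@derive1_at_min _ phi (-1 / 2) (1 / 2)) => //; first lra.
    by move=> t /dphi[].
  move=> t tI; have [t1 t2] := bnd t tI; rewrite /phi !mulr0 subr0 addr0 !powR1 !mulr1.
  rewrite addrC xy mulrC [x * _]mulrC; apply: H; [exact: ltW|exact: ltW|ring].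
case=> _ d0; have [_ d1] := dphi 0 z0.
move: d1; rewrite d0 !mulr0 subr0 addr0 !powR1 !mulr1 => /esym E.
have : p * (x - L * K) = 0 by rewrite -xy -[RHS]E; ring.
move=> /eqP; rewrite mulf_eq0 gt_eqF//= subr_eq0 => /eqP xE.
by split => //; lra.
Qed.

Section level_sets.
Context {R : realType} {d : measure_display} {X : metricMeasurableType R d}.
Variables (mu : {measure set X -> \bar R}) (p : R).
Hypotheses (p1 : 1 < p) (mu_borel : complete_borel mu).
Hypothesis mu_ball : forall (x : X) (r : R), 0 < r ->
  (0 < mu (ball x r))%E /\ (mu (ball x r) < +oo)%E.
Local Open Scope ereal_scope.

Let p0 : (0 < p)%R. Proof. exact: lt_trans p1. Qed.

Lemma int_pow_disjoint (f g : X -> \bar R) (k1 k2 : R) : (0 <= k1)%R -> (0 <= k2)%R ->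
  nonneg_measurable f -> nonneg_measurable g ->
  {ae mu, forall x, f x = 0 \/ g x = 0} ->
  int_pow mu p (fun x => k1%:E * f x + k2%:E * g x) =
  (k1 `^ p)%:E * int_pow mu p f + (k2 `^ p)%:E * int_pow mu p g.
Proof.
move=> k10 k20 [f0 mf] [g0 mg] fg.
have kf0 x : 0 <= k1%:E * f x by rewrite mule_ge0.
have kg0 x : 0 <= k2%:E * g x by rewrite mule_ge0.
have mkf : measurable_fun setT (fun x => k1%:E * f x) by exact: emeasurable_funM.
have mkg : measurable_fun setT (fun x => k2%:E * g x) by exact: emeasurable_funM.
rewrite -(int_powZ _ _ k10 (conj f0 mf)) -(int_powZ _ _ k20 (conj g0 mg)).
rewrite !int_powE//; last by move=> x; rewrite adde_ge0.
rewrite -ge0_integralD//; last 4 first.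
- by move=> x _; exact: poweR_ge0.
- exact: measurable_int_pow.
- by move=> x _; exact: poweR_ge0.
- exact: measurable_int_pow.
apply: ge0_ae_eq_integral => //.
- by apply: measurable_int_pow; exact: emeasurable_funD.
- by apply: emeasurable_funD; exact: measurable_int_pow.
- by move=> x _; exact: poweR_ge0.
- by move=> x _; rewrite adde_ge0// poweR_ge0.
- apply: filterS fg => x fgx _.
  by case: fgx => ->; rewrite mule0 poweR0r ?gt_eqF// ?add0e ?adde0.
Qed.

Lemma wug_shift (f : X -> R) (g : X -> \bar R) (k : R) :
  weak_upper_gradient mu p (EFin \o f) g ->
  weak_upper_gradient mu p (fun x => (f x + k)%:E) g.
Proof.
move=> [ng [G eG h]]; split => //; exists G => // c /h; rewrite /= -?EFinB.
by rewrite (_ : (f (c 0) + k - (f (c (curve_len c)) + k) = f (c 0) - f (c (curve_len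
  c)))%R)//; ring.
Qed.

(** The restriction of [g] to a strip of levels of [f] need not be measurable along curves, so it is
    replaced by a majorant that agrees with it a.e., which suffices for energies. *)
Lemma eclamp_gradient (f g : X -> \bar R) (m M : R) : measurable_fun setT f ->
  weak_upper_gradient mu p f g -> density mu p g -> (m <= M)%R ->
  exists h, [/\ density mu p h, int_pow mu p h <= int_pow mu p g,
    weak_upper_gradient mu p (EFin \o (fun x => eclamp m M (f x))) h &
    {ae mu, forall x, h x = if m%:E < f x < M%:E then g x else 0}].
Proof.
move=> mf fg dg mM; have := controls_eclamp mf (density_wug_controls p0 mu_borel fg dg) mM.
set q := (fun x => if _ then _ else _) => fq.
have qg : int_pow mu p q <= int_pow mu p g.
  apply: int_pow_le => // x; first exact: fq.1.1.
  by rewrite /q; case: ifP => // _; exact: dg.1.1.1.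
have [h [dh fh E aeh]] := wug_density_majorant p0 mu_borel fq (le_lt_trans qg dg.2).
by exists h; split => //; rewrite E.
Qed.

Section potential.
Variables (E A : set X) (u : X -> \bar R).
Hypotheses (EA : E `<=` A) (bA : bounded_subset A).
Hypothesis cap_fin : variational_capacity mu p E A < +oo.
Hypothesis u_pot : capacitary_potential mu p E A u.

Let potential_gradient : exists g Z, [/\ density mu p g,
  weak_upper_gradient mu p u g, int_pow mu p g = variational_capacity mu p E A,
  thin mu p Z & (forall x, ~ Z x -> E x -> 1 <= u x) /\ (forall x, ~ Z x -> ~ A x -> u x = 0)].
Proof.
have [[nu [Z1 cZ1 hZ1] [Z2 cZ2 hZ2]] uE] := u_pot.
have [g ug goo] := newtonian_wug nu.
have [um _] := min_wugP p0 mu_borel mu_ball ug goo.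
have [|g' [dg' ug' g'E _]] := wug_density_majorant p0 mu_borel um.
  by rewrite -/(dirichlet_energy mu p u) uE.
exists g', (Z1 `|` Z2); split => //; first by rewrite g'E -uE.
  by apply: thinU => //; exact: capacity0_thin.
by split => x nZ; [apply: hZ1 => Zx; apply: nZ; left|apply: hZ2 => Zx; apply: nZ; right].
Qed.

Variables (a b : R).
Hypotheses (a0 : (0 <= a)%R) (ab : (a < b)%R) (b1 : (b <= 1)%R).

(* Outside the levels between [a] and [b] the competitor follows a multiple of
   [u], between them it is replaced by a multiple of [v]. *)
Lemma competitor (g : X -> \bar R) (Z : set X) (v : X -> R) (h : X -> \bar R) (al be : R) :
  density mu p g -> weak_upper_gradient mu p u g -> thin mu p Z ->
  (forall x, ~ Z x -> E x -> 1 <= u x) -> (forall x, ~ Z x -> ~ A x -> u x = 0) ->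
  measurable_fun setT (EFin \o v) -> (forall x, 0 <= v x <= 1)%R -> density mu p h ->
  weak_upper_gradient mu p (EFin \o v) h ->
  (forall x, ~ Z x -> E x -> v x = 1%R) -> (forall x, ~ Z x -> ~ A x -> v x = 0%R) ->
  {ae mu, forall x, ~~ (a%:E <= u x <= b%:E) -> h x = 0} ->
  (0 <= al)%R -> (0 <= be)%R -> (al * (1 - (b - a)) + be = 1)%R ->
  variational_capacity mu p E A <=
    (al `^ p)%:E * int_pow mu p (fun x => if a%:E <= u x <= b%:E then 0 else g x) +
    (be `^ p)%:E * int_pow mu p h.
Proof.
move=> dg ug tZ uE uA mv v01 dh vh vE vA h0 al0 be0 albe.
have mu_ : measurable_fun setT u by have [[[]]] := u_pot.
set q := (fun x => if _ then _ else _).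
have nq : nonneg_measurable q.
  split; first by move=> x; rewrite /q; case: ifP => // _; exact: dg.1.1.1.
  apply: measurable_fun_ifT => //; last exact: dg.1.1.2.
  by apply: measurable_and; apply: measurable_fun_lee.
have [g1 [dg1 _ wg1 ae1]] := eclamp_gradient mu_ ug dg a0.
have [g2 [dg2 _ wg2 ae2]] := eclamp_gradient mu_ ug dg b1.
have [w12 c12] := wug_lincomb p0 mu_borel ler01 ler01 wg1 dg1.1 wg2 dg2.1.
have [w3 c3] := wug_lincomb p0 mu_borel al0 be0 (wug_shift (- b)%R w12) c12 vh dh.1.
(* The upper truncation starts at [b], hence the shift. The two truncations rise by a and 1 - b, [v]
   by 1, so the total rise is al (1 - (b - a)) + be = 1. *)
pose w x := (al * (1 * eclamp 0 a (u x) + 1 * eclamp b 1 (u x) - b) + be * v x)%R.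
set G := (fun x => al%:E * _ + _) in w3 c3.
have ab1 : (0 <= a + 1 - b)%R by have := a0; have := b1; lra.
have Gq : int_pow mu p G <= int_pow mu p (fun x => al%:E * q x + be%:E * h x).
  apply: ae_int_pow_le => //; first exact: c3.1.
    split; first by move=> x; rewrite adde_ge0// mule_ge0//; [exact: nq.1|exact: dh.1.1.1].
    apply: emeasurable_funD; apply: emeasurable_funM => //; [exact: nq.2|exact: dh.1.1.2].
  (* The truncation gradients live on {0 < u < a} and {b < u < 1}, which are disjoint and avoid the
     closed strip, so their sum is at most [q]. *)
  apply: filterS2 ae1 ae2 => x E1 E2; rewrite /G leeD2r// lee_wpmul2l// !mul1e E1 E2 /q.
  have g0 := dg.1.1.1 x; have abE : a%:E < b%:E by rewrite lte_fin.
  have [ua|au] := ltP (u x) a%:E.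
    rewrite [b%:E < u x]ltNge (ltW (lt_trans ua abE))/= adde0.
    by case: ifP.
  rewrite andbF add0e/=; have [ub|bu] := leP (u x) b%:E; first by [].
  by case: ifP.
have disj : {ae mu, forall x, q x = 0 \/ h x = 0}.
  by apply: filterS h0 => x hx; rewrite /q; case: ifPn => [_|/hx]; [left|right].
rewrite -(int_pow_disjoint al0 be0 nq dh.1.1 disj).
have [goo|] := ltP (int_pow mu p (fun x => al%:E * q x + be%:E * h x)) +oo; last first.
  by rewrite leye_eq => /eqP ->; rewrite leey.
apply: (le_trans _ Gq); apply: (@variational_capacity_le_test _ _ _ mu p p0 mu_borel
  mu_ball _ _ Z w G 1%R) => //.
- rewrite /w; apply/measurable_EFinP; apply: measurable_funD.
    apply: measurable_funM => //; apply: measurable_funB => //.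
    by apply: measurable_funD; apply: measurable_funM => //; apply/measurable_EFinP;
      exact: measurable_eclamp.
  by apply: measurable_funM => //; exact/measurable_EFinP.
- move=> x; have /andP[v0 v1] := v01 x.
  have /andP[c10 c1a] := eclamp_itv (u x) a0; have /andP[c2b c21] := eclamp_itv (u x) b1.
  rewrite /w !mul1r ger0_norm; last by rewrite addr_ge0// mulr_ge0//; lra.
  rewrite -[leRHS]albe; apply: lerD; first by apply: ler_wpM2l => //; lra.
  by rewrite -[leRHS]mulr1; apply: ler_wpM2l.
- exact: le_lt_trans Gq goo.
- move=> x nZ Ex; rewrite /w vE// !mul1r; have ux := uE x nZ Ex.
  rewrite (eclamp_ge a0); last first.
    by apply: le_trans ux; rewrite lee_fin; have := ab; have := b1; lra.
  by rewrite (eclamp_ge b1)//; lra.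
- move=> x nZ nAx; rewrite /w vA// uA// !mul1r.
  rewrite (eclamp_le a0)// (eclamp_le b1); last first.
    by rewrite lee_fin; have := a0; have := ab; lra.
  by ring.
Qed.

(** [F] and [G] are squeezed between strict and non-strict level sets, which treats all four
    condensers at once. That [F] contains the points of [A] with u >= 1 makes a test function for
    (F, G) at least 1 q.e. on [E]; for strict level sets this needs b < 1. *)
Lemma level_capacity (F G : set X) :
  [set x | A x /\ b%:E < u x] `<=` F -> F `<=` [set x | A x /\ b%:E <= u x] ->
  (forall x, A x -> 1 <= u x -> F x) ->
  [set x | A x /\ a%:E < u x] `<=` G -> G `<=` [set x | A x /\ a%:E <= u x] ->
  variational_capacity mu p F G =
  ((b - a) `^ (1 - p))%:E * variational_capacity mu p E A.
Proof.
move=> bF Fb F1 aG Ga.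
have [g [Z [dg ug gK tZ [uE uA]]]] := potential_gradient.
have mu_ : measurable_fun setT u by have [[[]]] := u_pot.
have g0 := dg.1.1.1; have mg := dg.1.1.2.
pose L := (b - a)%R; have L0 : (0 < L)%R by rewrite subr_gt0.
have L1 : (L <= 1)%R by rewrite /L; have := a0; have := b1; lra.
have abE : a%:E < b%:E by rewrite lte_fin.
pose q x := if a%:E <= u x <= b%:E then 0 else g x.
pose g2 x := if a%:E < u x < b%:E then g x else 0.
have nq : nonneg_measurable q.
  split; first by move=> x; rewrite /q; case: ifP.
  by apply: measurable_fun_ifT => //; apply: measurable_and; apply: measurable_fun_lee.
have ng2 : nonneg_measurable g2.
  split; first by move=> x; rewrite /g2; case: ifP.
  by apply: measurable_fun_ifT => //; apply: measurable_and; apply: measurable_fun_lte.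
set K := variational_capacity mu p E A.
have K0 : 0 <= K by rewrite /K -gK int_pow_ge0.
(* Only an inequality: [g2] lives on the open strip and [q] off the closed one, so both vanish on {u
   = a} and {u = b}. *)
have qg2K : int_pow mu p g2 + int_pow mu p q <= K.
  have := @int_pow_disjoint g2 q 1 1 ler01 ler01 ng2 nq.
  rewrite powR1 !mul1e => <-; last first.
    apply/aeW => x; rewrite /g2 /q; case: ifPn => [/andP[au ub]|_]; last by left.
    by right; rewrite !ltW.
  rewrite /K -gK; apply: (int_pow_le mu p0) => x.
    by rewrite !mul1e adde_ge0//; [exact: ng2.1|exact: nq.1].
  rewrite !mul1e /g2 /q; case: ifPn => [/andP[au ub]|_];
    first by rewrite (ltW au) (ltW ub) adde0.
  by rewrite add0e; case: ifP.
have x20 : 0 <= int_pow mu p g2 by exact: int_pow_ge0.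
have y0 : 0 <= int_pow mu p q by exact: int_pow_ge0.
have Kfin : K \is a fin_num by rewrite ge0_fin_numE.
have x2fin : int_pow mu p g2 \is a fin_num.
  by rewrite ge0_fin_numE//; apply: le_lt_trans cap_fin; apply: le_trans qg2K; exact: leeDl.
have yfin : int_pow mu p q \is a fin_num.
  by rewrite ge0_fin_numE//; apply: le_lt_trans cap_fin; apply: le_trans qg2K; exact: leeDr.
have [h1 [dh1 _ wh1 aeh1]] := eclamp_gradient mu_ ug dg (ltW ab).
pose v x := (L^-1 * (eclamp a b (u x) - a))%R.
pose h x := L^-1%:E * h1 x.
have LV0 : (0 <= L^-1)%R by rewrite invr_ge0 ltW.
have ch : curve_measurable h.
  split; first (split; first by move=> x; rewrite mule_ge0//; exact: dh1.1.1.1).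
    by apply: emeasurable_funM => //; exact: dh1.1.1.2.
  by move=> c; apply: emeasurable_funM => //; exact: dh1.1.2.
have h1E : int_pow mu p h1 = int_pow mu p g2.
  apply/eqP; rewrite eq_le; apply/andP; split; apply: ae_int_pow_le => //;
    try exact: dh1.1.1; by apply: filterS aeh1 => x ->.
have hE : int_pow mu p h = (L^-1 `^ p)%:E * int_pow mu p g2.
  by rewrite int_powZ//; [rewrite h1E|exact: dh1.1.1].
have dh : density mu p h.
  split => //; rewrite hE -(fineK x2fin) -EFinM; exact: ltry.
have vh : weak_upper_gradient mu p (EFin \o v) h.
  have [w _] := wug_lincomb p0 mu_borel LV0 (lexx 0%R) (wug_shift (- a)%R wh1) dh1.1 wh1 dh1.1.
  have wE : (fun x => (L^-1 * (eclamp a b (u x) - a) + 0 * eclamp a b (u x))%:E) = EFin \o v.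
    by apply/funext => x; rewrite mul0r addr0.
  rewrite wE in w; apply: wug_le w _ ch.1 => x.
  by rewrite mul0e adde0.
have mv : measurable_fun setT (EFin \o v).
  apply/measurable_EFinP; apply: measurable_funM => //; apply: measurable_funB => //.
  by apply/measurable_EFinP; exact: measurable_eclamp (ltW ab) mu_.
have v01 x : (0 <= v x <= 1)%R.
  have /andP[ca cb] := eclamp_itv (u x) (ltW ab).
  by rewrite /v mulr_ge0 ?subr_ge0//= mulrC ler_pdivrMr// mul1r /L; lra.
have v1 x : b%:E <= u x -> v x = 1%R.
  by move=> bu; rewrite /v (eclamp_ge (ltW ab))// -/L mulVf// gt_eqF.
have v0 x : u x <= a%:E -> v x = 0%R.
  by move=> ua; rewrite /v (eclamp_le (ltW ab))// subrr mulr0.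
have vE x : ~ Z x -> E x -> v x = 1%R.
  by move=> nZ Ex; apply: v1; apply: le_trans (uE x nZ Ex); rewrite lee_fin.
have vA x : ~ Z x -> ~ A x -> v x = 0%R.
  by move=> nZ nA; apply: v0; rewrite uA// lee_fin.
have h0 : {ae mu, forall x, ~~ (a%:E <= u x <= b%:E) -> h x = 0}.
  apply: filterS aeh1 => x h1x; rewrite /h h1x; case: ifPn; last by rewrite mule0.
  by move=> /andP[/ltW -> /ltW ->].
have [x2E yE] : fine (int_pow mu p g2) = (L * fine K)%R /\
    fine (int_pow mu p q) = ((1 - L) * fine K)%R.
  apply: (@energy_balance _ p) => //; try exact: fine_ge0.
    by rewrite -lee_fin EFinD !fineK.
  move=> al be al0 be0 albe.
  (* The energy of [h] carries the factor L^-p, so stretching by be inside the strip means using [v]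
     with the factor be L. *)
  have := competitor dg ug tZ uE uA mv v01 dh vh vE vA h0 al0 (mulr_ge0 be0 (ltW L0)) albe.
  rewrite -/K -/q hE muleA -EFinM -powRM ?mulr_ge0 ?(ltW L0)//.
  rewrite mulfK ?gt_eqF// -(fineK Kfin) -(fineK yfin) -(fineK x2fin) -!EFinM -EFinD.
  by rewrite lee_fin.
have pL : ((L^-1 `^ p) * L = L `^ (1 - p))%R.
  have Lp0 : (L `^ p)%R != 0%R by rewrite gt_eqF// powR_gt0.
  apply: (mulIf Lp0); rewrite mulrAC -powRM ?(ltW L0)// mulVf ?gt_eqF// powR1 mul1r.
  by rewrite powRB ?(gt_eqF L0) ?implybT// powRr1 ?(ltW L0)// divfK.
apply/eqP; rewrite eq_le; apply/andP; split.
  have -> : (L `^ (1 - p))%:E * K = int_pow mu p h.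
    by rewrite hE -(fineK x2fin) x2E -(fineK Kfin) -!EFinM mulrA pL.
  apply: (@variational_capacity_le_test _ _ _ mu p p0 mu_borel mu_ball _ _ Z v h 1%R) => //.
  - by move=> x /Fb[Ax bu]; apply: aG; split => //; exact: lt_le_trans bu.
  - by have [x0 [r Ar]] := bA; exists x0, r => x /Ga[/Ar].
  - by move=> x; have /andP[? ?] := v01 x; rewrite ger0_norm.
  - exact: dh.2.
  - by move=> x _ /Fb[_ bu]; rewrite v1.
  - move=> x nZ nG; have [Ax|nAx] := pselect (A x); last exact: vA.
    by apply: v0; rewrite leNgt; apply/negP => au; apply: nG; exact: aG.
apply: le_ereal_inf_tmp => _ [t [nt [t1 t0]] <-].
have [gt0 tg0 gt0oo] := newtonian_wug nt.
have [tm tmle] := min_wugP p0 mu_borel mu_ball tg0 gt0oo.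
have tmoo := le_lt_trans tmle gt0oo.
have [gt [dgt tgt gtE _]] := wug_density_majorant p0 mu_borel tm tmoo.
rewrite /dirichlet_energy -gtE.
(* An arbitrary test function is truncated to [0, 1], as gluing requires; this does not increase the
   energy. *)
have [k [dk kgt wk aek]] := eclamp_gradient nt.1 tgt dgt (@ler01 R).
(* Where u < a the point is outside [G] and t = 0; where u > b it lies in [F], up to [Z], and t >=
   1. In both cases the truncation has no gradient. *)
have k0 : {ae mu, forall x, ~~ (a%:E <= u x <= b%:E) -> k x = 0}.
  have nZae : {ae mu, forall x, ~ Z x}.
    by apply: negligibleS tZ.1 => x /= nnZ; exact: contrapT.
  apply: filterS2 aek nZae => x -> nZ; rewrite negb_and -!ltNge => /orP[ua|bu].
    by rewrite t0 ?ltxx// => /Ga[_]; rewrite leNgt ua.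
  case: ifPn => // /andP[_]; rewrite ltNge t1//; apply: bF; split => //.
  apply: contrapT => nA; move: bu; rewrite uA// lte_fin ltNge.
  by rewrite (ltW (le_lt_trans a0 ab)).
(* With al = 1 and be = L the function [u] is kept outside the strip, and K <= (1 - L) K + L^p times
   the energy of [k]; solving for that energy gives the lower bound. *)
have := @competitor g Z (fun x => eclamp 0 1 (t x)) k 1%R L dg ug tZ uE uA.
rewrite powR1 mul1e -/K -/q mul1r subrK => Hc.
have {Hc} : K <= int_pow mu p q + (L `^ p)%:E * int_pow mu p k.
  apply: Hc => //.
  - exact: measurable_eclamp nt.1.
  - by move=> x; exact: eclamp_itv.
  - move=> x nZ Ex; apply: eclamp_ge => //; apply: t1; apply: F1; first exact: EA.
    exact: uE.
  - move=> x nZ nA; apply: eclamp_le => //; rewrite t0// => /Ga[Ax _]; exact: nA.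
  - exact: ltW.
have kfin : int_pow mu p k \is a fin_num by rewrite ge0_fin_numE ?int_pow_ge0//; exact: dk.2.
move=> HK; apply: le_trans kgt; move: HK.
rewrite -(fineK Kfin) -(fineK yfin) -(fineK kfin) yE -!EFinM -EFinD !lee_fin => HK.
have Lp0 : (0 < L `^ p)%R by rewrite powR_gt0.
rewrite -(ler_pM2l Lp0) mulrA -pL.
have -> : (L `^ p * (L^-1 `^ p * L) = L)%R.
  by rewrite mulrA -powRM ?(ltW L0)// mulfV ?gt_eqF// powR1 mul1r.
by lra.
Qed.

End potential.
End level_sets.

Theorem theorem3p3 (R : realType) (d : measure_display)
    (X : metricMeasurableType R d) (mu : {measure set X -> \bar R}) (p : R)
    (E A : set X) (u : X -> \bar R)
    (p_gt1 : 1 < p)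
    (two_points : exists x y : X, x <> y)
    (mu_borel : complete_borel mu)
    (mu_ball : forall (x : X) (r : R), 0 < r ->
       (0 < mu (ball x r))%E /\ (mu (ball x r) < +oo)%E)
    (EA : E `<=` A) (bE : bounded_subset E) (bA : bounded_subset A)
    (cap_fin : (variational_capacity mu p E A < +oo)%E)
    (u_pot : capacitary_potential mu p E A u) :
  let A_gt (a : R) := [set x | A x /\ (a%:E < u x)%E] in
  let A_ge (a : R) := [set x | A x /\ (a%:E <= u x)%E] in
  (forall a b : R, 0 <= a -> a < b -> b <= 1 ->
     variational_capacity mu p (A_ge b) (A_gt a) =
       (((b - a) `^ (1 - p))%:E * variational_capacity mu p E A)%E /\
     variational_capacity mu p (A_ge b) (A_ge a) =
       (((b - a) `^ (1 - p))%:E * variational_capacity mu p E A)%E) /\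
  (forall a b : R, 0 <= a -> a < b -> b < 1 ->
     variational_capacity mu p (A_gt b) (A_gt a) =
       (((b - a) `^ (1 - p))%:E * variational_capacity mu p E A)%E /\
     variational_capacity mu p (A_gt b) (A_ge a) =
       (((b - a) `^ (1 - p))%:E * variational_capacity mu p E A)%E).
Proof.
move=> A_gt A_ge.
have level a b F G : 0 <= a -> a < b -> b <= 1 ->
    A_gt b `<=` F -> F `<=` A_ge b -> (forall x, A x -> (1 <= u x)%E -> F x) ->
    A_gt a `<=` G -> G `<=` A_ge a ->
    variational_capacity mu p F G =
    (((b - a) `^ (1 - p))%:E * variational_capacity mu p E A)%E.
  by move=> a0 ab b1; exact: (level_capacity p_gt1 mu_borel mu_ball EA bA cap_fin u_pot
    a0 ab b1).
have gt_ge c : A_gt c `<=` A_ge c by move=> x [Ax /ltW cu]; split.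
have ge1 c : c <= 1 -> forall x, A x -> (1 <= u x)%E -> A_ge c x.
  by move=> c1 x Ax ux; split => //; apply: le_trans ux; rewrite lee_fin.
have gt1 c : c < 1 -> forall x, A x -> (1 <= u x)%E -> A_gt c x.
  by move=> c1 x Ax ux; split => //; apply: lt_le_trans ux; rewrite lte_fin.
split=> a b a0 ab b1; split; apply: level => //;
  solve [exact: ge1|exact: gt1|exact: ltW].
Qed.
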